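(* Let $\lambda>0$, let $m\le n$ be positive integers and let $1\le r\le m$. Then \[ \sup_{X_0\in M_{m,n},\ \operatorname{rank}(X_0)\le r} R(\hat X_\lambda,X_0)=\lim_{\mu\to\infty}R(\hat X_\lambda,\mu C), \] where $C\in M_{m,n}$ is any fixed matrix of rank exactly $r$.
   Context: $M_{m,n}$ denotes the set of real $m\times n$ matrices, $\|\cdot\|_F$ the Frobenius norm and $\|X\|_*$ the nuclear norm (sum of singular values). For $\lambda>0$, the singular value soft thresholding (SVST) estimator is $\hat X_\lambda(Y)=\operatorname{argmin}_{X\in M_{m,n}}\frac12\|Y-X\|_F^2+\lambda\|X\|_*$; equivalently, if $Y=U\,\mathrm{diag}(y_1,\dots,y_m)V^T$ is a singular value decomposition, then $\hat X_\lambda(Y)=U\,\mathrm{diag}((y_1-\lambda)_+,\dots,(y_m-\lambda)_+)V^T$. For a measurable map $\hat X:M_{m,n}\to M_{m,n}$ and $X_0\in M_{m,n}$, the risk is $R(\hat X,X_0)=\frac1m\mathbb E\|\hat X(X_0+\frac{1}{\sqrt n}Z)-X_0\|_F^2$, where $Z\in M_{m,n}$ has i.i.d. $\mathcal N(0,1)$ entries. *)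

(* Defs.v *)
From HB Require Import structures.
From mathcomp Require Import all_boot all_order all_algebra.
From mathcomp Require Import all_classical all_reals all_analysis.
Set Implicit Arguments. Unset Strict Implicit. Unset Printing Implicit Defensive.
Import Order.TTheory GRing.Theory Num.Theory.
Import numFieldNormedType.Exports.
Local Open Scope classical_set_scope.
Local Open Scope ring_scope.

Section SVST.
Variables (R : realType) (m n : nat).

Definition rdiag (s : 'I_m -> R) : 'M[R]_(m, n) :=
  \matrix_(i < m, j < n) (if (i : nat) == (j : nat) then s i else 0).

Definition is_svd (Y : 'M[R]_(m, n)) (U : 'M[R]_m) (s : 'I_m -> R)
    (V : 'M[R]_n) : Prop :=
  [/\ U *m U^T = 1%:M, V *m V^T = 1%:M, (forall i, 0 <= s i)
    & Y = U *m rdiag s *m V^T].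

(* Singular value soft thresholding: U diag((y_i - lam)_+) V^T for an
   (arbitrarily chosen) SVD of Y; 0 if Y had no SVD (never happens). *)
Definition svst (lam : R) (Y : 'M[R]_(m, n)) : 'M[R]_(m, n) :=
  match pselect (exists t : 'M[R]_m * ('I_m -> R) * 'M[R]_n,
                   is_svd Y t.1.1 t.1.2 t.2) with
  | left H => let t := projT1 (cid H) in
      t.1.1 *m rdiag (fun i => Num.max (t.1.2 i - lam) 0) *m t.2^T
  | right _ => 0
  end.

Definition frob2 (A : 'M[R]_(m, n)) : R := \sum_i \sum_j (A i j) ^+ 2.

Fixpoint gauss_iter (k : nat) (F : (nat -> R) -> \bar R) (z : nat -> R)
    : \bar R :=
  match k with
  | 0 => F z
  | k'.+1 => (\int[normal_prob 0 1]_x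
                gauss_iter k' F (fun i => if i == k' then x else z i))%E
  end.

(* E[F(Z)] for Z an m x n matrix with i.i.d. N(0,1) entries (entry (i,j)
   is coordinate i*n+j); F is nonnegative here, so by Tonelli the iterated
   integral is the integral against the product Gaussian measure. *)
Definition gaussE (F : 'M[R]_(m, n) -> \bar R) : \bar R :=
  gauss_iter (m * n) (fun z => F (\matrix_(i < m, j < n) z (i * n + j)%N))
    (fun _ => 0).

Definition risk (Xhat : 'M[R]_(m, n) -> 'M[R]_(m, n)) (X0 : 'M[R]_(m, n))
    : \bar R :=
  ((m%:R)^-1%:E *
   gaussE (fun Z => (frob2 (Xhat (X0 + (Num.sqrt (n%:R))^-1 *: Z) - X0))%:E))%E.

End SVST.

(* Main.v *)
(* Y - svst lam Y is the metric projection P Y of Y on the ball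
   B = {W : |x W| <= lam |x| for all x}, so the loss at X with noise N is
   |N - P (X + N)|^2.  Let X = U diag(s) V^T and C = U diag(c) V^T with
   s <= a c, and put P0 = P (X + N), P1 = P (t C + N).  The variational inequality
   for P0 shows that the loss at t C exceeds the one at X by at least
   2 <X, P1 - P0>.  On B the linear forms <X, .> and <a C - X, .> are at most
   lam \sum s_i and lam \sum (a c_i - s_i), so <X, P0 - P1> is at most
   a (lam \sum c_i - <C, P1>), and the variational inequality for P1, tested
   against the maximizer lam U V^T of <C, .>, makes this O((1 + |N|^2) / t).
   A general C is moved to the singular vectors of X by orthogonal matrices, which
   does not change its risk because the Gaussian law is orthogonally invariant.
   Hence R(X) <= R(t C) + O(1/t) whenever \rank X <= \rank C.
   For the invariance, every invertible matrix is a product of matrices changing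
   one coordinate, so it scales iterated Lebesgue integrals by a constant; an
   orthogonal matrix preserves the Gaussian density, and integrating 1 shows that
   its constant is 1. *)

Require Import Defs.
From HB Require Import structures.
From mathcomp Require Import all_boot all_order all_algebra.
From mathcomp Require Import all_classical all_reals all_analysis.
From mathcomp Require Import measurable_realfun ring lra.
Set Implicit Arguments. Unset Strict Implicit. Unset Printing Implicit Defensive.
Import Order.TTheory GRing.Theory Num.Theory.
Import numFieldNormedType.Exports.
Local Open Scope classical_set_scope.
Local Open Scope ring_scope.

(** * Lebesgue and normal integrals *)

Section lebesgue_lemmas.
Context {R : realType}.
Local Notation mu := (@lebesgue_measure R).
Local Open Scope ereal_scope.

(** The Radon-Nikodym derivative of [normal_prob] and the function [normal_pdf] have the same
    integral over every measurable set, hence agree almost everywhere. *)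
Lemma ge0_integral_normal_prob (m s : R) (f : R -> \bar R) :
  (forall x, 0 <= f x) -> measurable_fun [set: R] f ->
  \int[normal_prob m s]_x f x = \int[mu]_x (f x * (normal_pdf m s x)%:E).
Proof.
move=> f0 mf.
have dom := normal_prob_dominates m s.
rewrite -(Radon_Nikodym_SigmaFinite.change_of_variables dom)//.
have int := Radon_Nikodym_SigmaFinite.f_integrable dom.
apply: ae_eq_integral => //.
- by apply: emeasurable_funM => //; exact: measurable_int int.
- apply: emeasurable_funM => //; apply/measurable_EFinP.
  exact: measurable_normal_pdf.
- apply: ae_eqe_mul2l.
  apply: integral_ae_eq => //=.
  + by apply/measurable_EFinP; exact: measurable_normal_pdf.
  + by move=> E _ mE; rewrite -Radon_Nikodym_SigmaFinite.f_integral.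
Qed.

(** The push-forward of Lebesgue measure under [x |-> a x + c], scaled by [|a|], agrees with
    Lebesgue measure on half-open intervals, hence everywhere by uniqueness. *)
Lemma ge0_integral_affine (f : R -> \bar R) (a c : R) : a != 0%R ->
  (forall x, 0 <= f x) -> measurable_fun [set: R] f ->
  \int[mu]_x f (a * x + c)%R = (`|a|^-1)%:E * \int[mu]_x f x.
Proof.
move=> a0 f0 mf.
pose phi := (fun x : R => a * x + c)%R : measurableTypeR R -> measurableTypeR R.
have mphi : measurable_fun [set: measurableTypeR R] phi.
  by apply: measurable_funD => //; exact: measurable_funM.
have na0 : (0 < `|a|)%R by rewrite normr_gt0.
pose k : {nonneg R} := NngNum (normr_ge0 a).
pose nu0 := mscale k (pushforward mu phi); pose nu := nu0 mphi.
have nuE A : measurable A -> mu A = nu A.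
  apply: lebesgue_measure_unique => _ [[x y]] _ <-.
  change (mu [set` `]x, y]%R] = `|a|%:E * mu (phi @^-1` [set` `]x, y]%R])).
  have [ap|an|/eqP] := ltgtP 0%R a; last by rewrite eq_sym (negbTE a0).
  - have -> : phi @^-1` `]x, y]%classic =
        [set` Interval (BRight ((x - c) / a)%R) (BRight ((y - c) / a)%R)].
      apply/seteqP; split => t /=; rewrite /phi !in_itv/= ltr_pdivrMr// ler_pdivlMr//;
      by move=> /andP[? ?]; apply/andP; split; lra.
    rewrite !lebesgue_measure_itv/= !lte_fin ltr_pM2r ?invr_gt0// ltrD2r.
    rewrite gtr0_norm//; case: ifPn => xy; last by rewrite mule0.
    by rewrite -!EFinD -EFinM; congr EFin; field.
  (* For negative [a] the preimage is closed on the left and open on the right; its length is not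
     affected. *)
  - have -> : phi @^-1` `]x, y]%classic =
        [set` Interval (BLeft ((y - c) / a)%R) (BLeft ((x - c) / a)%R)].
      apply/seteqP; split => t /=; rewrite /phi !in_itv/= ltr_ndivlMr// ler_ndivrMr//;
      by move=> /andP[? ?]; apply/andP; split; lra.
    rewrite !lebesgue_measure_itv/= !lte_fin ltr_nM2r ?invr_lt0// ltrD2r.
    rewrite ltr0_norm//; case: ifPn => xy; last by rewrite mule0.
    by rewrite -!EFinD -EFinM; congr EFin; field.
have -> : \int[mu]_x f x = \int[nu]_x f x.
  by apply: eq_measure_integral => A mA _; exact: nuE.
rewrite /nu /nu0 ge0_integral_mscale//= ge0_integral_pushforward//= preimage_setT.
by rewrite muleA -EFinM mulVf ?gt_eqF// mul1e.
Qed.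

End lebesgue_lemmas.

(** * Iterated integrals over coordinates *)

Section coordinates.
Context {R : realType}.
Local Notation mu := (@lebesgue_measure R).
Local Open Scope ereal_scope.

(** These cylinder sets generate the product sigma-algebra on sequences, the space on which
    [gauss_iter] operates. *)
Definition coord_sets : set (set (nat -> R)) :=
  [set B | exists i (A : set R), measurable A /\ B = (fun z => z i) @^-1` A].

Local Notation rseq := (g_sigma_algebraType coord_sets).
Implicit Types (F G : rseq -> \bar R) (z : rseq).

Lemma measurable_coord i : measurable_fun [set: rseq] (fun z : rseq => z i).
Proof.
move=> _ A mA; rewrite setTI; apply: sub_sigma_algebra.
by exists i, A.
Qed.

Lemma measurable_to_rseq d (X : measurableType d) (f : X -> rseq) :
  (forall i, measurable_fun [set: X] (fun x => f x i)) ->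
  measurable_fun [set: X] f.
Proof.
move=> mf; apply: (@measurability _ _ X rseq setT f coord_sets) => //.
move=> _ [_ [i [A [mA ->]]] <-].
by have := mf i measurableT A mA; rewrite !setTI.
Qed.

Definition upd (z : nat -> R) (k : nat) (x : R) : nat -> R :=
  fun i => if i == k then x else z i.

Lemma updE (z : nat -> R) k x : upd z k x k = x. Proof. by rewrite /upd eqxx. Qed.

Lemma updN (z : nat -> R) k x i : i != k -> upd z k x i = z i.
Proof. by rewrite /upd => /negbTE ->. Qed.

Lemma updC (z : nat -> R) p q x y : p != q -> upd (upd z p x) q y = upd (upd z q y) p x.
Proof.
move=> pq; apply/funext => i; rewrite /upd.
by have [->|//] := eqVneq i q; rewrite eq_sym (negbTE pq).
Qed.

Lemma measurable_upd d (X : measurableType d) p (f : X -> rseq) (g : X -> R) :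
  measurable_fun [set: X] f -> measurable_fun [set: X] g ->
  measurable_fun [set: X] (fun x => upd (f x) p (g x) : rseq).
Proof.
move=> mf mg; apply: measurable_to_rseq => i; rewrite /upd.
case: eqP => // _; exact: (measurableT_comp (measurable_coord i) mf).
Qed.

Definition coord_int p (F : rseq -> \bar R) (z : rseq) : \bar R :=
  \int[mu]_x F (upd z p x).

Lemma coord_int_ge0 p F z : (forall z, 0 <= F z) -> 0 <= coord_int p F z.
Proof. by move=> F0; apply: integral_ge0. Qed.

Lemma measurable_slice p F z : measurable_fun [set: rseq] F ->
  measurable_fun [set: R] (fun x => F (upd z p x)).
Proof.
move=> mF; apply: (measurableT_comp mF).
by apply: measurable_upd => //; exact: measurable_cst.
Qed.

(** Tonelli for [(z, x) |-> F (upd z p x)], which is jointly measurable. *)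
Lemma measurable_coord_int p F : measurable_fun [set: rseq] F ->
  (forall z, 0 <= F z) -> measurable_fun [set: rseq] (coord_int p F).
Proof.
move=> mF F0.
apply: (measurable_fun_fubini_tonelli_F (m2 := mu)
  (fun zx : rseq * measurableTypeR R => F (upd zx.1 p zx.2))) => //=.
apply: (measurableT_comp mF).
exact: measurable_upd.
Qed.

Lemma coord_intC p q F : measurable_fun [set: rseq] F ->
  (forall z, 0 <= F z) ->
  coord_int p (coord_int q F) = coord_int q (coord_int p F).
Proof.
move=> mF F0; have [->//|pq] := eqVneq p q.
apply/funext => z; rewrite /coord_int.
have := @fubini_tonelli _ _ _ _ R mu mu
  (fun xy : measurableTypeR R * measurableTypeR R => F (upd (upd z p xy.1) q xy.2)).
move=> ->//=.
- apply: eq_integral => y _; apply: eq_integral => x _.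
  by rewrite updC// eq_sym.
- apply: (measurableT_comp mF); apply: measurable_upd => //.
  by apply: measurable_upd => //; exact: measurable_cst.
Qed.

Lemma coord_intZ p (c : rseq -> R) F : measurable_fun [set: rseq] F ->
  (forall z, 0 <= F z) -> (forall z, (0 <= c z)%R) ->
  (forall z x, c (upd z p x) = c z) ->
  coord_int p (fun z => F z * (c z)%:E) = fun z => coord_int p F z * (c z)%:E.
Proof.
move=> mF F0 c0 cp; apply/funext => z; rewrite /coord_int.
under eq_integral do rewrite cp.
by rewrite ge0_integralZr//=; [exact: measurable_slice|rewrite lee_fin].
Qed.

(** Lebesgue counterpart of [gauss_iter], with the same order of integration. *)
Fixpoint leb_iter k (F : rseq -> \bar R) : rseq -> \bar R :=
  if k is k'.+1 then coord_int k' (leb_iter k' F) else F.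

Lemma leb_iter_ge0 k F z : (forall z, 0 <= F z) -> 0 <= leb_iter k F z.
Proof. by move=> F0; elim: k z => //= k IH z; exact: coord_int_ge0. Qed.

Lemma measurable_leb_iter k F : measurable_fun [set: rseq] F ->
  (forall z, 0 <= F z) -> measurable_fun [set: rseq] (leb_iter k F).
Proof.
move=> mF F0; elim: k => //= k IH; apply: measurable_coord_int => // z.
exact: leb_iter_ge0.
Qed.

Lemma leb_iterC k p F : measurable_fun [set: rseq] F -> (forall z, 0 <= F z) ->
  coord_int p (leb_iter k F) = leb_iter k (coord_int p F).
Proof.
move=> mF F0; elim: k => //= k <-; rewrite coord_intC//.
- exact: measurable_leb_iter.
- by move=> z; exact: leb_iter_ge0.
Qed.

Lemma leb_iterZ k (c : rseq -> R) F : measurable_fun [set: rseq] F ->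
  (forall z, 0 <= F z) -> (forall z, (0 <= c z)%R) ->
  (forall p z x, (p < k)%N -> c (upd z p x) = c z) ->
  leb_iter k (fun z => F z * (c z)%:E) = fun z => leb_iter k F z * (c z)%:E.
Proof.
move=> mF F0 c0; elim: k => //= k IH cp.
rewrite IH; last by move=> p z x pk; rewrite cp// ltnW.
rewrite coord_intZ//.
- exact: measurable_leb_iter.
- by move=> z; exact: leb_iter_ge0.
- by move=> z x; rewrite cp.
Qed.

(** By Tonelli the integration over coordinate [p] can be carried out first, so a factor relating
    the [p]-slices passes to the whole iterated integral. *)
Lemma leb_iter_coord_int k p (c : R) F G : (p < k)%N -> (0 <= c)%R ->
  measurable_fun [set: rseq] F -> (forall z, 0 <= F z) ->
  measurable_fun [set: rseq] G -> (forall z, 0 <= G z) ->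
  (forall z, coord_int p F z = coord_int p G z * c%:E) ->
  forall z, leb_iter k F z = leb_iter k G z * c%:E.
Proof.
move=> pk c0 mF F0 mG G0 FG.
have {}FG : coord_int p F = fun z => coord_int p G z * c%:E by apply/funext.
suff : leb_iter k F = fun z => leb_iter k G z * c%:E by move=> ->.
elim: k pk => //= k IH; rewrite ltnS leq_eqVlt => /predU1P[<-|pk].
  rewrite !leb_iterC// FG (leb_iterZ (c := fun=> c))//.
  - exact: measurable_coord_int.
  - by move=> z; exact: coord_int_ge0.
rewrite IH// (coord_intZ (c := fun=> c))//.
- exact: measurable_leb_iter.
- by move=> z; exact: leb_iter_ge0.
Qed.

End coordinates.
Notation rseq R := (g_sigma_algebraType (@coord_sets R)).

(** * Generation of the linear group *)

Section row_replacement.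
Context {F : fieldType} {N : nat}.
Implicit Types (A : 'M[F]_N) (v w : 'I_N -> F) (p : 'I_N).

(** As a linear map it alters coordinate [p] alone, so one substitution on the line computes its
    effect on an integral. *)
Definition rowrep p v : 'M[F]_N :=
  \matrix_(i, j) if i == p then v j else (i == j)%:R.

Lemma rowrep_mulE p v A i j :
  (rowrep p v *m A) i j = if i == p then \sum_k v k * A k j else A i j.
Proof.
rewrite mxE; case: (altP (i =P p)) => [->|ip].
  by apply: eq_bigr => k _; rewrite mxE eqxx.
rewrite (bigD1 i)//= mxE (negbTE ip) eqxx mul1r big1 ?addr0// => k ki.
by rewrite mxE (negbTE ip) eq_sym (negbTE ki) mul0r.
Qed.

(** The inverse solves [y_p = \sum_j w_j x_j] for [x_p], which again alters coordinate [p] alone. *)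
Lemma rowrep_inv p w : w p != 0 ->
  exists2 v, v p != 0 & rowrep p v *m rowrep p w = 1%:M.
Proof.
move=> wp; exists (fun j => if j == p then (w p)^-1 else - (w j / w p)).
  by rewrite eqxx invr_eq0.
apply/matrixP => i j; rewrite rowrep_mulE [RHS]mxE.
case: (altP (i =P p)) => [->|ip]; last by rewrite mxE (negbTE ip).
rewrite (bigD1 p)//= eqxx mxE eqxx.
have [->|jp] := eqVneq j p.
  rewrite mulVf// big1 ?addr0// => k kp.
  by rewrite mxE (negbTE kp) mulr0.
rewrite (bigD1 j)//= mxE (negbTE jp) eqxx.
rewrite big1 ?addr0 => [|k /andP[kp kj]]; first by rewrite mulr1 [w j / _]mulrC addrN.
by rewrite mxE (negbTE kp) (negbTE kj) mulr0.
Qed.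

(** Elimination from the last row to the first: at stage [k] the rows of index at least [k] are
    those of the identity. A vanishing pivot is repaired by adding one row to another, again a row
    replacement. *)
Lemma unitmx_rowrep_ind (P : 'M[F]_N -> Prop) :
  P 1%:M -> (forall A B, P A -> P B -> P (A *m B)) ->
  (forall p v, v p != 0 -> P (rowrep p v)) ->
  forall A, A \in unitmx -> P A.
Proof.
move=> P1 PM PR.
have PL p w A : w p != 0 -> P (rowrep p w *m A) -> P A.
  move=> /rowrep_inv[v vp vw] /(PM _ _ (PR p v vp)).
  by rewrite mulmxA vw mul1mx.
have UL p w A : w p != 0 -> A \in unitmx -> rowrep p w *m A \in unitmx.
  move=> /rowrep_inv[v vp /mulmx1_unit[_ Uw]] UA.
  by rewrite unitmx_mul Uw.
suff H k A : (k <= N)%N -> A \in unitmx ->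
    (forall i j : 'I_N, (k <= i)%N -> A i j = (i == j)%:R) -> P A.
  by move=> A UA; apply: (H N) => // i j; rewrite leqNgt ltn_ord.
elim: k A => [|k IH] A kN UA Ak.
  suff -> : A = 1%:M by [].
  by apply/matrixP => i j; rewrite Ak// mxE.
pose p := Ordinal kN.
(* If row p of A^-1 has a nonzero p-th entry, row p can be turned into e_p. *)
have step B : B \in unitmx -> invmx B p p != 0 ->
    (forall i j : 'I_N, (k < i)%N -> B i j = (i == j)%:R) -> P B.
  move=> UB Bp Bk; apply: (PL p (invmx B p)) => //; apply: IH (ltnW kN) _ _.
    exact: UL.
  move=> i j; rewrite rowrep_mulE leq_eqVlt => /orP[/eqP ki|ki].
    have -> : i = p by apply/val_inj.
    have /matrixP/(_ p j) := mulVmx UB.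
    by rewrite !mxE eqxx.
  by rewrite Bk//; case: (altP (i =P p)) ki => // -> /=; rewrite ltnn.
have [Ap|Ap] := eqVneq (invmx A p p) 0; last exact: step.
(* Row [p] of [invmx A] times column [p] of [A] is 1, and this column vanishes at the indices above
   [k], so some earlier entry of the row is nonzero. *)
have [j jk Aj] : exists2 j : 'I_N, (j <= k)%N & invmx A p j != 0.
  apply/exists_inP; apply: contraT => /exists_inPn A0.
  have /matrixP/(_ p p) := mulVmx UA.
  rewrite !mxE eqxx big1 => [/eqP|i _]; first by rewrite eq_sym oner_eq0.
  have [ik|ki] := leqP i k; first by rewrite (eqP (negbNE (A0 i ik))) mul0r.
  rewrite Ak//; case: eqP => [ip|]; last by rewrite mulr0.
  by rewrite ip ltnn in ki.
have jp : j != p by apply: contraNneq Aj => ->; rewrite Ap.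
(* [rowrep j w] adds row [p] to row [j] and [rowrep j v] undoes this; the diagonal entry of the
   inverse at [p] becomes [- invmx A p j]. *)
pose w l : F := (l == j)%:R + (l == p)%:R.
pose v l : F := (l == j)%:R - (l == p)%:R.
have wj : w j != 0 by rewrite /w eqxx (negbTE jp) addr0 oner_neq0.
apply: (PL j w) => //.
have vw : rowrep j v *m rowrep j w = 1%:M.
  apply/matrixP => a b; rewrite rowrep_mulE !mxE.
  case: (altP (a =P j)) => [->|//].
  rewrite (bigD1 j)//= (bigD1 p)//= 1?eq_sym// big1 => [|l /andP[lj lp]]; last first.
    by rewrite /v (negbTE lj) (negbTE lp) subr0 mul0r.
  rewrite !mxE eqxx /v /w !eqxx (negbTE jp) (eq_sym p j) (negbTE jp).
  by rewrite (eq_sym p b) /=; ring.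
have Uw : rowrep j w *m A \in unitmx by exact: UL.
apply: step => //.
- have -> : invmx (rowrep j w *m A) = invmx A *m rowrep j v.
    apply: (can_inj (mulmxK Uw)); rewrite mulVmx//.
    by rewrite -mulmxA (mulmxA (rowrep j v)) vw mul1mx mulVmx.
  rewrite mxE (bigD1 p)//= Ap mul0r add0r (bigD1 j) ?jp//=.
  rewrite big1 => [|l /andP[lp lj]]; last first.
    by rewrite mxE (negbTE lj) (negbTE lp) mulr0.
  by rewrite mxE eqxx /v (eq_sym p j) (negbTE jp) eqxx sub0r mulrN1 addr0 oppr_eq0.
- move=> a b ka; rewrite rowrep_mulE Ak//; case: eqP => // aj.
  by move: ka; rewrite aj ltnNge jk.
Qed.

End row_replacement.

(** * Orthogonal invariance of the iterated Gaussian integral *)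

Section gauss_orthogonal.
Context {R : realType}.
Local Notation mu := (@lebesgue_measure R).
Local Notation rseq := (rseq R).
Implicit Types (F G : rseq -> \bar R) (z : rseq).

Definition gauss_dens k z : R := \prod_(i < k) normal_pdf 0 1 (z i).

Lemma gauss_dens_ge0 k z : 0 <= gauss_dens k z.
Proof. by apply: prodr_ge0 => i _; exact: normal_pdf_ge0. Qed.

(** The density depends on [z] only through a sum of squares, the quantity that an orthogonal matrix
    preserves. *)
Lemma gauss_densE k z : gauss_dens k z =
  normal_peak 1 ^+ k * expR (- (\sum_(i < k) z i ^+ 2) / 2).
Proof.
rewrite /gauss_dens (eq_bigr (fun i : 'I_k => normal_peak 1 * expR (- z i ^+ 2 / 2))).
  rewrite big_split/= prodr_const card_ord -expR_sum; congr (_ * expR _).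
  by rewrite mulNr mulr_suml -sumrN; apply: eq_bigr => i _; rewrite mulNr.
move=> i _; rewrite normal_pdfE ?oner_neq0//; congr (_ * expR _).
by rewrite subr0 expr1n.
Qed.

Lemma measurable_gauss_dens k : measurable_fun [set: rseq] (gauss_dens k).
Proof.
apply: measurable_prod => i _.
exact: (measurableT_comp (measurable_normal_pdf 0 1) (measurable_coord i)).
Qed.

(** The density factor of coordinate [k] is constant in the coordinates below [k], so it leaves the
    inner integrals and joins the outer one. *)
Lemma gauss_iterE k F : measurable_fun [set: rseq] F -> (forall z, (0 <= F z)%E) ->
  gauss_iter k F = leb_iter k (fun z => F z * (gauss_dens k z)%:E)%E.
Proof.
move=> mF F0; elim: k => [|k IH].
  by apply/funext => z /=; rewrite /gauss_dens big_ord0 mule1.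
have dens k' : measurable_fun [set: rseq] (fun z => F z * (gauss_dens k' z)%:E)%E.
  by apply: emeasurable_funM => //; apply/measurable_EFinP; exact: measurable_gauss_dens.
have dens0 k' z : (0 <= F z * (gauss_dens k' z)%:E)%E.
  by rewrite mule_ge0// lee_fin gauss_dens_ge0.
apply/funext => z /=; rewrite /coord_int IH.
rewrite -/(upd _ _ _) ge0_integral_normal_prob; last 2 first.
- by move=> x; exact: leb_iter_ge0.
- by apply: (@measurable_slice R k _ z); exact: measurable_leb_iter.
apply: eq_integral => x _.
have -> : (fun z => F z * (gauss_dens k.+1 z)%:E)%E =
    (fun z => F z * (gauss_dens k z)%:E * (normal_pdf 0 1 (z k))%:E)%E.
  apply/funext => y; rewrite -muleA -EFinM; congr (_ * _%:E)%E.
  by rewrite /gauss_dens big_ord_recr.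
rewrite (leb_iterZ (c := fun z => normal_pdf 0 1 (z k)))//.
- by rewrite updE.
- by move=> y; exact: normal_pdf_ge0.
- by move=> p y t pk; rewrite updN// neq_ltn pk orbT.
Qed.

Lemma gauss_iter_ge0 k F z : (forall z, (0 <= F z)%E) -> (0 <= gauss_iter k F z)%E.
Proof. by move=> F0; elim: k z => //= k IH z; apply: integral_ge0. Qed.

Lemma measurable_gauss_iter k F : measurable_fun [set: rseq] F ->
  (forall z, (0 <= F z)%E) -> measurable_fun [set: rseq] (gauss_iter k F).
Proof.
move=> mF F0; rewrite gauss_iterE//; apply: measurable_leb_iter.
  by apply: emeasurable_funM => //; apply/measurable_EFinP; exact: measurable_gauss_dens.
by move=> z; rewrite mule_ge0// lee_fin gauss_dens_ge0.
Qed.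

Lemma gauss_iter_cst k (c : R) z : 0 <= c -> gauss_iter k (cst c%:E) z = c%:E.
Proof.
move=> c0; elim: k z => //= k IH z.
rewrite (eq_integral (cst c%:E)) => [|x _]; last by rewrite IH.
by rewrite integral_cst//= probability_setT mule1.
Qed.

Lemma le_gauss_iter k F G z : measurable_fun [set: rseq] F ->
  (forall z, (0 <= F z)%E) -> measurable_fun [set: rseq] G ->
  (forall z, (F z <= G z)%E) -> (gauss_iter k F z <= gauss_iter k G z)%E.
Proof.
move=> mF F0 mG FG.
have G0 t : (0 <= G t)%E by rewrite (le_trans (F0 t)).
elim: k z => //= k IH z; apply: ge0_le_integral => //.
- by move=> x _; exact: gauss_iter_ge0.
- by apply: (@measurable_slice R k _ z); exact: measurable_gauss_iter.
- by apply: (@measurable_slice R k _ z); exact: measurable_gauss_iter.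
Qed.

Lemma gauss_iterD k F G z : measurable_fun [set: rseq] F ->
  (forall z, (0 <= F z)%E) -> measurable_fun [set: rseq] G ->
  (forall z, (0 <= G z)%E) ->
  gauss_iter k (fun z => F z + G z)%E z = (gauss_iter k F z + gauss_iter k G z)%E.
Proof.
move=> mF F0 mG G0; elim: k z => //= k IH z.
under eq_integral do rewrite IH.
rewrite ge0_integralD//.
- by move=> x _; exact: gauss_iter_ge0.
- by apply: (@measurable_slice R k _ z); exact: measurable_gauss_iter.
- by move=> x _; exact: gauss_iter_ge0.
- by apply: (@measurable_slice R k _ z); exact: measurable_gauss_iter.
Qed.

Lemma gauss_iterZ k (c : R) F z : measurable_fun [set: rseq] F ->
  (forall z, (0 <= F z)%E) -> 0 <= c ->
  gauss_iter k (fun z => c%:E * F z)%E z = (c%:E * gauss_iter k F z)%E.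
Proof.
move=> mF F0 c0; elim: k z => //= k IH z.
under eq_integral do rewrite IH.
rewrite ge0_integralZl//.
- by apply: (@measurable_slice R k _ z); exact: measurable_gauss_iter.
- by move=> x _; exact: gauss_iter_ge0.
Qed.

Definition linact {N} (A : 'M[R]_N) z : rseq :=
  fun i => if insub i is Some p then \sum_j A p j * z (nat_of_ord j) else z i.

Lemma linactE N (A : 'M[R]_N) z (p : 'I_N) : linact A z p = \sum_j A p j * z j.
Proof. by rewrite /linact valK. Qed.

Lemma linact_ge N (A : 'M[R]_N) z i : (N <= i)%N -> linact A z i = z i.
Proof. by move=> Ni; rewrite /linact insubF// ltnNge Ni. Qed.

Lemma rseq_ordP N z1 z2 : (forall p : 'I_N, z1 p = z2 p) ->
  (forall i, (N <= i)%N -> z1 i = z2 i) -> z1 = z2.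
Proof.
move=> H1 H2; apply/funext => i; have [iN|] := ltnP i N; last exact: H2.
exact: (H1 (Ordinal iN)).
Qed.

Lemma linact1 N z : linact (1%:M : 'M[R]_N) z = z.
Proof.
apply: (@rseq_ordP N) => [p|i Ni]; last by rewrite linact_ge.
rewrite linactE (bigD1 p)//= mxE eqxx mul1r big1 ?addr0// => j jp.
by rewrite mxE eq_sym (negbTE jp) mul0r.
Qed.

Lemma linactM N (A B : 'M[R]_N) z : linact (A *m B) z = linact A (linact B z).
Proof.
apply: (@rseq_ordP N) => [p|i Ni]; last by rewrite !linact_ge.
rewrite !linactE; under [RHS]eq_bigr do rewrite linactE mulr_sumr.
rewrite exchange_big/=; apply: eq_bigr => j _.
by rewrite mxE mulr_suml; apply: eq_bigr => k _; rewrite mulrA.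
Qed.

Lemma measurable_linact N (A : 'M[R]_N) : measurable_fun [set: rseq] (linact A).
Proof.
apply: measurable_to_rseq => i; rewrite /linact.
case: insub => [p|]; last exact: measurable_coord.
apply: measurable_sum => j; apply: measurable_funM => //.
exact: measurable_coord.
Qed.

(** Along coordinate [p] the map is affine with slope [v p]; the other coordinates contribute only a
    translation. *)
Lemma leb_iter_rowrep N (p : 'I_N) (v : 'I_N -> R) F z : v p != 0 ->
  measurable_fun [set: rseq] F -> (forall z, (0 <= F z)%E) ->
  (leb_iter N (F \o linact (rowrep p v)) z = leb_iter N F z * `|v p|^-1%:E)%E.
Proof.
move=> vp mF F0; apply: (leb_iter_coord_int (p := p)) => //.
- exact: (measurableT_comp mF (measurable_linact _)).
- by move=> y /=.
move=> y; rewrite /coord_int muleC.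
rewrite -(@ge0_integral_affine _ (fun x => F (upd y p x)) (v p)
  (\sum_(j < N | j != p) v j * y j))//; last exact: measurable_slice.
apply: eq_integral => x _ /=; congr F.
apply: (@rseq_ordP N) => [i|i Ni]; last first.
  rewrite linact_ge// !updN//; by rewrite neq_ltn (leq_trans (ltn_ord p) Ni) orbT.
rewrite linactE; have [->|ip] := eqVneq i p.
  rewrite updE (bigD1 p)//= mxE eqxx updE; congr (_ + _).
  by apply: eq_bigr => j jp; rewrite mxE eqxx updN.
rewrite (bigD1 i)//= mxE (negbTE ip) eqxx mul1r big1 ?addr0.
  by rewrite !updN.
by move=> j ji; rewrite mxE (negbTE ip) eq_sym (negbTE ji) mul0r.
Qed.

(** The property passes to products and holds for row replacements. The constant is chosen before
    [F], so that a single integrand determines it. *)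
Lemma leb_iter_linact N (A : 'M[R]_N) : A \in unitmx -> exists c : R, forall F z,
  measurable_fun [set: rseq] F -> (forall z, (0 <= F z)%E) ->
  (leb_iter N (F \o linact A) z = leb_iter N F z * c%:E)%E.
Proof.
move: A; apply: unitmx_rowrep_ind.
- exists 1 => F z _ _; rewrite mule1; congr (leb_iter _ _ _).
  by apply/funext => y /=; rewrite linact1.
- move=> A B [a IA] [b IB]; exists (a * b) => F z mF F0.
  rewrite EFinM muleA -IA// -IB//.
  + congr (leb_iter _ _ _); apply/funext => y /=;
    by rewrite linactM.
  + exact: (measurableT_comp mF (measurable_linact _)).
  + by move=> y /=.
- by move=> p v vp; exists `|v p|^-1 => F z; exact: leb_iter_rowrep.
Qed.

Lemma gauss_iter_linact N (A : 'M[R]_N) F z : A^T *m A = 1%:M ->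
  measurable_fun [set: rseq] F -> (forall z, (0 <= F z)%E) ->
  gauss_iter N (F \o linact A) z = gauss_iter N F z.
Proof.
move=> AA mF F0; have [_ UA] := mulmx1_unit AA.
have densA y : gauss_dens N (linact A y) = gauss_dens N y.
  suff nA : \sum_(i < N) linact A y i ^+ 2 = \sum_(i < N) y i ^+ 2.
    by rewrite !gauss_densE nA.
  under eq_bigr do rewrite linactE.
  pose x : 'cV[R]_N := \col_j y j.
  transitivity (((A *m x)^T *m (A *m x)) 0 0).
    rewrite mxE; apply: eq_bigr => i _; rewrite !mxE expr2.
    by congr (_ * _); apply: eq_bigr => j _; rewrite mxE.
  rewrite trmx_mul mulmxA -(mulmxA _ A^T) AA mulmx1 mxE.
  by apply: eq_bigr => i _; rewrite !mxE expr2.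
have [c Ic] := leb_iter_linact UA.
have H G y : measurable_fun [set: rseq] G -> (forall z, (0 <= G z)%E) ->
    (gauss_iter N (G \o linact A) y = gauss_iter N G y * c%:E)%E.
  move=> mG G0; rewrite !gauss_iterE//.
  - rewrite -Ic//.
    + by congr (leb_iter _ _ _); apply/funext => t /=; rewrite densA.
    + by apply: emeasurable_funM => //; apply/measurable_EFinP; exact: measurable_gauss_dens.
    + by move=> t; rewrite mule_ge0// lee_fin gauss_dens_ge0.
  - exact: (measurableT_comp mG (measurable_linact _)).
  - by move=> t /=.
(* The integrand 1 has Gaussian integral 1 before and after the substitution. *)
have c1 : c = 1.
  have := @H (cst 1%E) z (measurable_cst _) (fun=> lee01).
  rewrite (_ : cst 1%E \o linact A = cst 1%E)// gauss_iter_cst// mul1e => -[] //.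
by rewrite H// c1 mule1.
Qed.

End gauss_orthogonal.

(** * Measurability of Lipschitz functions and Gaussian second moments *)

Section lipschitz_moment.
Context {R : realType}.
Local Notation mu := (@lebesgue_measure R).
Local Notation rseq := (rseq R).

(** A countable family of points, dense in the first [N] coordinates. *)
Definition rat_seq N (q : {ffun 'I_N -> rat}) : nat -> R :=
  fun i => if insub i is Some p then ratr (q p) else 0.

Lemma measurable_lipschitz N (f : rseq -> R) (K : R) :
  (forall z y, `|f z - f y| <= K * \sum_(i < N) `|z i - y i|) ->
  measurable_fun [set: rseq] f.
Proof.
move=> fK.
pose K' : R := `|K| + 1; have K0 : 0 < K' by rewrite ltr_wpDl.
have {}fK z y : `|f z - f y| <= K' * \sum_(i < N) `|z i - y i|.
  apply: le_trans (fK z y) _; apply: ler_wpM2r; first exact: sumr_ge0.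
  by rewrite (le_trans (ler_norm K))// lerDl.
move: K' K0 fK => {}K K0 fK.
apply: (measurability _ (RGenInftyO.measurableE R)) => _ [_ [a ->] <-].
rewrite setTI.
(* A K-Lipschitz f is the infimum of f q + K |z - q| over the rational points q. *)
pose h (q : {ffun 'I_N -> rat}) (z : rseq) : R :=
  f (rat_seq q) + K * \sum_(i < N) `|z i - rat_seq q i|.
have -> : f @^-1` `]-oo, a[ =
    \bigcup_(q in [set: {ffun 'I_N -> rat}]) h q @^-1` `]-oo, a[.
  apply/seteqP; split => z /=; rewrite in_itv/=; last first.
    move=> [q _] /=; rewrite in_itv/= /h; apply: le_lt_trans.
    rewrite -lerBlDl; apply: le_trans (fK _ _).
    exact: ler_norm.
  (* With this [e] the number [K N e] is below half the gap [a - f z]: one half pays for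
     [f q - f z], the other for the penalty in [h]. Using [N.+1] keeps the denominator nonzero. *)
  move=> fza; pose e := (a - f z) / (2 * K * N.+1%:R).
  have e0 : 0 < e by rewrite divr_gt0 ?subr_gt0// !mulr_gt0.
  have qP (i : 'I_N) : exists q : rat, `|z i - ratr q| < e.
    have [q] : exists q : rat, ratr q \in `]z i - e, z i + e[.
      by apply: rat_in_itvoo; rewrite ltrD2l gtrN.
    rewrite in_itv/= => /andP[q1 q2]; exists q.
    by rewrite ltr_norml; apply/andP; split; lra.
  exists [ffun i => sval (cid (qP i))] => //=.
  rewrite in_itv/= /h; set q := rat_seq _.
  have zq : \sum_(i < N) `|z i - q i| <= N%:R * e.
    rewrite mulrC mulr_natr -[X in _ *+ X](card_ord N) -sumr_const.
    apply: ler_sum => i _.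
    by rewrite /q /rat_seq valK ffunE; case: cid => /= r /ltW.
  have {}zq : K * \sum_(i < N) `|z i - q i| < (a - f z) / 2.
    apply: (@le_lt_trans _ _ (K * (N%:R * e))); first by rewrite ler_pM2l.
    apply: (@lt_le_trans _ _ (K * (N.+1%:R * e))).
      by rewrite ltr_pM2l// ltr_pM2r// ltr_nat.
    rewrite le_eqVlt; apply/orP; left; apply/eqP; rewrite /e; field.
    by rewrite gt_eqF//= gt_eqF.
  have := fK q z; rewrite ler_norml => /andP[_ fqz].
  have : f q - f z < (a - f z) / 2.
    apply: le_lt_trans fqz _; apply: le_lt_trans zq.
    by under eq_bigr do rewrite distrC.
  lra.
apply: countable_bigcupT_measurable; first exact: countableP.
move=> q; rewrite -[X in measurable X]setTI.
have mh : measurable_fun [set: rseq] (h q).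
  apply: measurable_funD => //; apply: measurable_funM => //.
  apply: measurable_sum => i; apply: measurableT_comp => //.
  by apply: measurable_funB => //; exact: measurable_coord.
by apply: mh => //; exact: measurable_itv.
Qed.

Lemma normal_prob_sqr_lty : (\int[normal_prob 0 1]_x ((x : R) ^+ 2)%:E < +oo)%E.
Proof.
rewrite ge0_integral_normal_prob; last 2 first.
- by move=> x; rewrite lee_fin sqr_ge0.
- by apply/measurable_EFinP; apply: measurable_funX.
(* x^2 <= 4 exp(x^2 / 4), and 4 exp(- x^2 / 4) is a multiple of the density of N(0, 2). *)
set s : R := Num.sqrt 2.
have s0 : s != 0 by rewrite gt_eqF// sqrtr_gt0.
pose c : R := normal_peak 1 * 4 / normal_peak s.
have p0 : 0 < normal_peak s by exact: normal_peak_gt0.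
have c0 : 0 <= c by rewrite divr_ge0 ?mulr_ge0 ?normal_peak_ge0.
apply: (@le_lt_trans _ _ (\int[mu]_x (c%:E * (normal_pdf 0 s x)%:E))%E); last first.
  rewrite ge0_integralZl//=.
  - by rewrite integral_normal_pdf mule1 ltry.
  - by apply/measurable_EFinP; exact: measurable_normal_pdf.
  - by move=> x _; rewrite lee_fin normal_pdf_ge0.
apply: ge0_le_integral => //=.
- by move=> x _; rewrite -EFinM lee_fin mulr_ge0 ?sqr_ge0 ?normal_pdf_ge0.
- apply/measurable_EFinP; apply: measurable_funM; first exact: measurable_funX.
  exact: measurable_normal_pdf.
- apply/measurable_EFinP; apply: measurable_funM => //.
  exact: measurable_normal_pdf.
- move=> x _; rewrite -!EFinM lee_fin !normal_pdfE ?oner_neq0//.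
  rewrite /normal_fun !subr0 expr1n /s sqr_sqrtr//.
  have -> : c * (normal_peak (Num.sqrt 2) * expR (- x ^+ 2 / (2 *+ 2))) =
      normal_peak 1 * (4 * expR (- x ^+ 2 / (2 *+ 2))).
    by rewrite /c -/s; field; rewrite gt_eqF.
  rewrite mulrCA ler_wpM2l ?normal_peak_ge0//.
  have -> : - x ^+ 2 / (1 *+ 2) = - x ^+ 2 / (2 *+ 2) + - x ^+ 2 / (2 *+ 2) by field.
  rewrite expRD mulrA ler_wpM2r ?expR_ge0//.
  rewrite mulNr expRN ler_pdivrMr ?expR_gt0//.
  have := expR_ge1Dx (x ^+ 2 / (2 *+ 2)).
  by have := sqr_ge0 x; lra.
Qed.

Lemma gauss_iter_sqr_lty N (i : 'I_N) (z : rseq) :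
  (gauss_iter N (fun z => (z i ^+ 2)%:E) z < +oo)%E.
Proof.
pose s := (\int[normal_prob 0 1]_x ((x : R) ^+ 2)%:E)%E.
have s0 : (0 <= s)%E by apply: integral_ge0 => x _; rewrite lee_fin sqr_ge0.
have sE : (fine s)%:E = s by rewrite fineK// ge0_fin_numE//; exact: normal_prob_sqr_lty.
(* Nothing happens until coordinate [i] is integrated, which yields the second moment [s]; later
   integrations average a constant. *)
have H k y : gauss_iter k (fun z => (z i ^+ 2)%:E) y =
    (if (k <= i)%N then (y i ^+ 2)%:E else s).
  elim: k y => //= k IH y.
  under eq_integral do rewrite IH.
  have [ki|ik|ki] := ltngtP k i.
  - rewrite (eq_integral (cst (y i ^+ 2)%:E)) => [|//].
    by rewrite integral_cst//= probability_setT mule1.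
  - rewrite (eq_integral (cst s)) // -sE.
    by rewrite integral_cst//= probability_setT mule1.
  - by apply: eq_integral => x _; rewrite ?ki ?eqxx.
by rewrite H leqNgt ltn_ord/= -sE ltry.
Qed.

Lemma gauss_iter_quadratic_lty N (a b : R) (z : rseq) : 0 <= a -> 0 <= b ->
  (gauss_iter N (fun z => (a + b * \sum_(i < N) z i ^+ 2)%:E) z < +oo)%E.
Proof.
move=> a0 b0.
have mE (f : rseq -> R) : measurable_fun [set: rseq] f ->
  measurable_fun [set: rseq] (fun z => (f z)%:E) by move=> ?; exact/measurable_EFinP.
have mX i : measurable_fun [set: rseq] (fun z : rseq => z i ^+ 2).
  by apply: measurable_funX; exact: measurable_coord.
suff H r : (gauss_iter N
    (fun z => (a + \sum_(i <- r) b * z (i : 'I_N) ^+ 2)%:E) z < +oo)%E.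
  have := H (index_enum _); congr (_ < _)%E; congr (gauss_iter _ _ _).
  by apply/funext => y; rewrite mulr_sumr.
elim: r => [|i r IH].
  rewrite (_ : (fun _ => _) = cst a%:E) ?gauss_iter_cst ?ltry//.
  by apply/funext => y; rewrite big_nil addr0.
rewrite (_ : (fun _ => _) = (fun y => b%:E * (y (i : nat) ^+ 2)%:E +
    (a + \sum_(i <- r) b * y (i : 'I_N) ^+ 2)%:E)%E); last first.
  by apply/funext => y; rewrite big_cons -EFinM -EFinD; congr EFin; ring.
rewrite gauss_iterD.
- rewrite gauss_iterZ//.
  + apply: lte_add_pinfty => //; apply: lte_mul_pinfty => //.
    exact: gauss_iter_sqr_lty.
  + exact: mE.
  + by move=> y; rewrite lee_fin sqr_ge0.
- by apply: (mE (fun y => b * y i ^+ 2)); apply: measurable_funM.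
- by move=> y; rewrite -EFinM lee_fin mulr_ge0 ?sqr_ge0.
- apply: mE; apply: measurable_funD => //.
  by apply: measurable_sum => j; apply: measurable_funM.
- move=> y; rewrite lee_fin addr_ge0// sumr_ge0// => j _.
  by rewrite mulr_ge0 ?sqr_ge0.
Qed.

End lipschitz_moment.

(** * Gaussian expectation over matrices *)

Section gaussE_lemmas.
Context {R : realType} {m n : nat}.
Local Notation rseq := (rseq R).
Local Notation M := 'M[R]_(m, n).
Implicit Types (F G : M -> \bar R).

Definition mat_of_seq (z : nat -> R) : M := \matrix_(i, j) z (i * n + j)%N.

Definition meas_mat F := measurable_fun [set: rseq] (F \o mat_of_seq).

Lemma gaussE_le F G : meas_mat F -> meas_mat G ->
  (forall Z, (0 <= F Z)%E) -> (forall Z, (F Z <= G Z)%E) ->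
  (gaussE F <= gaussE G)%E.
Proof. by move=> mF mG F0 FG; apply: le_gauss_iter => // z. Qed.

Lemma gaussE_ge0 F : (forall Z, (0 <= F Z)%E) -> (0 <= gaussE F)%E.
Proof. by move=> F0; apply: gauss_iter_ge0. Qed.

Lemma gaussED F G : meas_mat F -> meas_mat G ->
  (forall Z, (0 <= F Z)%E) -> (forall Z, (0 <= G Z)%E) ->
  gaussE (fun Z => F Z + G Z)%E = (gaussE F + gaussE G)%E.
Proof.
by move=> mF mG F0 G0; apply: (gauss_iterD _ _ mF _ mG) => z; rewrite /=.
Qed.

Lemma gaussEZ (c : R) F : meas_mat F -> (forall Z, (0 <= F Z)%E) -> 0 <= c ->
  gaussE (fun Z => c%:E * F Z)%E = (c%:E * gaussE F)%E.
Proof. by move=> mF F0 c0; apply: (gauss_iterZ _ _ mF) => // z /=. Qed.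

Lemma flat_proof (i : 'I_m) (j : 'I_n) : (i * n + j < m * n)%N.
Proof.
have im := ltn_ord i; have jn := ltn_ord j.
by apply: (@leq_trans (i.+1 * n)); rewrite ?leq_mul2r ?im ?orbT// mulSn addnC ltn_add2r.
Qed.
(** The numbering of entries built into [gaussE]; [flat_row] and [flat_col] invert it by Euclidean
    division. *)
Definition flat i j : 'I_(m * n) := Ordinal (flat_proof i j).

Lemma flat_row_proof (l : 'I_(m * n)) : (l %/ n < m)%N.
Proof.
have n0 : (0 < n)%N by case: (posnP n) (ltn_ord l) => // {2}->; rewrite muln0.
by rewrite ltn_divLR// ltn_ord.
Qed.
Definition flat_row l : 'I_m := Ordinal (flat_row_proof l).

Lemma flat_col_proof (l : 'I_(m * n)) : (l %% n < n)%N.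
Proof.
have n0 : (0 < n)%N by case: (posnP n) (ltn_ord l) => // {2}->; rewrite muln0.
by rewrite ltn_mod.
Qed.
Definition flat_col l : 'I_n := Ordinal (flat_col_proof l).

Lemma flat_rowK i j : flat_row (flat i j) = i.
Proof.
apply: val_inj => /=; have jn := ltn_ord j.
by rewrite divnMDl ?divn_small ?addn0// (leq_ltn_trans _ jn).
Qed.

Lemma flat_colK i j : flat_col (flat i j) = j.
Proof. by apply: val_inj => /=; rewrite modnMDl modn_small. Qed.

Lemma flatK l : flat (flat_row l) (flat_col l) = l.
Proof. by apply: val_inj => /=; rewrite -divn_eq. Qed.

Lemma sum_flat (V : nmodType) (G : 'I_(m * n) -> V) :
  \sum_l G l = \sum_i \sum_j G (flat i j).
Proof.
rewrite pair_big/= (reindex (fun ij => flat ij.1 ij.2)) ?big_mkcond//=.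
apply: onW_bij; exists (fun l => (flat_row l, flat_col l)) => [[i j]|l] /=.
  by rewrite flat_rowK flat_colK.
exact: flatK.
Qed.

Lemma frob2_mat_of_seq z : frob2 (mat_of_seq z) = \sum_(l < m * n) z l ^+ 2.
Proof. by rewrite sum_flat; apply: eq_bigr => i _; apply: eq_bigr => j _; rewrite mxE. Qed.

(** In row-major coordinates [Z |-> U Z V] is the Kronecker product of [U] and [V^T], an orthogonal
    matrix, so [gauss_iter_linact] applies. *)
Lemma gaussE_orthogonal (U : 'M[R]_m) (V : 'M[R]_n) F :
  U *m U^T = 1%:M -> V *m V^T = 1%:M ->
  meas_mat F -> (forall Z, (0 <= F Z)%E) ->
  gaussE (fun Z => F (U *m Z *m V)) = gaussE F.
Proof.
move=> UU VV mF F0.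
pose A : 'M[R]_(m * n) := \matrix_(k, l)
  (U (flat_row k) (flat_row l) * V (flat_col l) (flat_col k)).
have AE z : mat_of_seq (linact A z) = U *m mat_of_seq z *m V.
  apply/matrixP => i j.
  transitivity (linact A z (flat i j)); first by rewrite mxE.
  rewrite linactE sum_flat [RHS]mxE.
  rewrite exchange_big/=; apply: eq_bigr => l _; rewrite mxE mulr_suml.
  apply: eq_bigr => k _.
  by rewrite !mxE !flat_rowK !flat_colK mulrAC.
have AA : A^T *m A = 1%:M.
  apply: mulmx1C; apply/matrixP => k l; rewrite !mxE sum_flat.
  transitivity ((U *m U^T) (flat_row k) (flat_row l) * (V^T *m V) (flat_col k) (flat_col l)).
    rewrite !mxE big_distrlr/=; apply: eq_bigr => i _; apply: eq_bigr => j _.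
    by rewrite !mxE !flat_rowK !flat_colK mulrACA.
  rewrite UU (mulmx1C VV) !mxE -natrM mulnb; congr (nat_of_bool _)%:R.
  apply/andP/eqP => [[/eqP rE /eqP cE]|->//].
  by rewrite -(flatK k) -(flatK l) rE cE.
rewrite /gaussE -(gauss_iter_linact _ AA mF) => [|z /=//].
congr (gauss_iter _ _ _); apply/funext => z /=.
by rewrite -AE.
Qed.

Lemma gaussE_frob2_lty (a b : R) : 0 <= a -> 0 <= b ->
  (gaussE (fun Z : M => (a + b * frob2 Z)%:E) < +oo)%E.
Proof.
move=> a0 b0; have := gauss_iter_quadratic_lty (m * n) (fun=> 0) a0 b0.
congr (_ < _)%E; congr (gauss_iter _ _ _); apply/funext => z.
by rewrite -frob2_mat_of_seq.
Qed.

Lemma measurable_mat_lipschitz (f : M -> R) (K : R) :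
  (forall Z Y, `|f Z - f Y| <= K * \sum_i \sum_j `|Z i j - Y i j|) ->
  measurable_fun [set: rseq] (f \o mat_of_seq).
Proof.
move=> fK; apply: (@measurable_lipschitz _ (m * n) _ K) => z y /=.
apply: le_trans (fK _ _) _; rewrite le_eqVlt; apply/orP; left; apply/eqP.
rewrite sum_flat; congr (_ * _).
by apply: eq_bigr => i _; apply: eq_bigr => j _; rewrite !mxE.
Qed.

End gaussE_lemmas.

(** * Frobenius product and singular value decomposition *)

Section frobenius.
Context {R : realType}.

Definition frobp {m n} (A B : 'M[R]_(m, n)) : R := \tr (A *m B^T).

Context {m n : nat}.
Implicit Types A B C D : 'M[R]_(m, n).

Lemma frobpE A B : frobp A B = \sum_i \sum_j A i j * B i j.
Proof. by apply: eq_bigr => i _; rewrite mxE; apply: eq_bigr => j _; rewrite mxE. Qed.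

Lemma frob2E A : frob2 A = frobp A A.
Proof. by rewrite frobpE; apply: eq_bigr => i _; apply: eq_bigr => j _; rewrite expr2. Qed.

Lemma frobpC A B : frobp A B = frobp B A.
Proof. by rewrite /frobp -mxtrace_tr trmx_mul trmxK. Qed.

Lemma frobpDl A B C : frobp (A + B) C = frobp A C + frobp B C.
Proof. by rewrite /frobp mulmxDl mxtraceD. Qed.

Lemma frobpDr A B C : frobp C (A + B) = frobp C A + frobp C B.
Proof. by rewrite !(frobpC C) frobpDl. Qed.

Lemma frobpZl a A B : frobp (a *: A) B = a * frobp A B.
Proof. by rewrite /frobp -scalemxAl mxtraceZ. Qed.

Lemma frobpZr a A B : frobp A (a *: B) = a * frobp A B.
Proof. by rewrite !(frobpC A) frobpZl. Qed.

Lemma frobpNl A B : frobp (- A) B = - frobp A B.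
Proof. by rewrite -scaleN1r frobpZl mulN1r. Qed.

Lemma frobpNr A B : frobp A (- B) = - frobp A B.
Proof. by rewrite !(frobpC A) frobpNl. Qed.

Lemma frobp0l A : frobp 0 A = 0.
Proof. by rewrite /frobp mul0mx mxtrace0. Qed.

Definition frobpL := (frobpDl, frobpDr, frobpNl, frobpNr, frobpZl, frobpZr).

Lemma frobp_ge0 A : 0 <= frobp A A.
Proof. by rewrite -frob2E; apply: sumr_ge0 => i _; apply: sumr_ge0 => j _; exact: sqr_ge0. Qed.

Lemma frobp_eq0 A : frobp A A <= 0 -> A = 0.
Proof.
rewrite -frob2E => A0; have : frob2 A == 0.
  by rewrite eq_le A0 frob2E frobp_ge0.
rewrite psumr_eq0 => [/allP H|i _]; last by apply: sumr_ge0 => j _; exact: sqr_ge0.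
apply/matrixP => i j; have := H i (mem_index_enum _).
rewrite psumr_eq0 => [/allP/(_ j (mem_index_enum _))|k _]; last exact: sqr_ge0.
by rewrite /= sqrf_eq0 mxE => /eqP.
Qed.

Lemma frobp_mull {k} (U : 'M[R]_(m, k)) (A : 'M[R]_(k, n)) B :
  frobp (U *m A) B = frobp A (U^T *m B).
Proof. by rewrite /frobp trmx_mul trmxK -mulmxA mxtrace_mulC mulmxA. Qed.

Lemma frobp_mulr {k} (A : 'M[R]_(m, k)) (V : 'M[R]_(k, n)) B :
  frobp (A *m V) B = frobp A (B *m V^T).
Proof. by rewrite /frobp trmx_mul trmxK mulmxA. Qed.

Lemma frobp_orth (U : 'M[R]_m) (V : 'M[R]_n) A B : U^T *m U = 1%:M -> V *m V^T = 1%:M ->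
  frobp (U *m A *m V) (U *m B *m V) = frobp A B.
Proof.
by move=> UU VV; rewrite frobp_mulr -!mulmxA VV mulmx1 frobp_mull mulmxA UU mul1mx.
Qed.

Lemma entry_le_frobp A i j : A i j ^+ 2 <= frobp A A.
Proof.
rewrite -frob2E /frob2 (bigD1 i)//= (bigD1 j)//= -addrA lerDl addr_ge0//.
  by apply: sumr_ge0 => k _; exact: sqr_ge0.
by apply: sumr_ge0 => k _; apply: sumr_ge0 => l _; exact: sqr_ge0.
Qed.

Lemma sum_sqr_le (I : finType) (x : I -> R) :
  \sum_i x i ^+ 2 <= (\sum_i `|x i|) ^+ 2.
Proof.
rewrite [leRHS]expr2 mulr_suml; apply: ler_sum => i _.
rewrite -real_normK ?num_real// expr2.
by rewrite ler_wpM2l// (bigD1 i)//= lerDl sumr_ge0.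
Qed.

Lemma frobp_le_sum A : frobp A A <= (\sum_i \sum_j `|A i j|) ^+ 2.
Proof.
rewrite -frob2E /frob2 !pair_big/=.
exact: (sum_sqr_le (fun p : 'I_m * 'I_n => A p.1 p.2)).
Qed.

End frobenius.

Lemma frobp_delta {R : realType} {n} (x : 'rV[R]_n) j : frobp x (delta_mx 0 j) = x 0 j.
Proof.
rewrite frobpE big_ord1 (bigD1 j)//= mxE !eqxx mulr1 big1 ?addr0// => i ij.
by rewrite mxE (negbTE ij) andbF mulr0.
Qed.

(** * Existence of singular value decompositions *)

Section svd.
Context {R : realType}.

(** The reflection along [u - e] exchanges the unit vectors [e] and [u]; for [u = e] the identity
    serves. *)
Lemma householder N (u : 'rV[R]_N.+1) : frobp u u = 1 ->
  exists H : 'M[R]_N.+1,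
    [/\ H^T = H, H *m H = 1%:M & delta_mx 0 0 *m H = u].
Proof.
move=> u1; set e : 'rV[R]_N.+1 := delta_mx 0 0.
have fe x : frobp e x = x 0 0 by rewrite frobpC frobp_delta.
have [ue|ue] := eqVneq u e.
  by exists 1%:M; rewrite trmx1 !mulmx1 ue.
have [w wE] : {w : 'rV[R]_N.+1 | w = u - e} by exists (u - e).
pose c := 2 / frobp w w.
have w0 : frobp w w != 0.
  apply: contra_neq ue => w0; apply/eqP; rewrite -subr_eq0; apply/eqP.
  by apply: frobp_eq0; rewrite -wE w0.
have wwE : frobp w w = 2 - 2 * u 0 0.
  rewrite wE !frobpL u1 !fe (frobpC u) fe mxE !eqxx/=; ring.
have ww : w *m w^T = (frobp w w)%:M.
  apply/matrixP => i j; rewrite !ord1 [RHS]mxE eqxx mulr1n /frobp /mxtrace big_ord1.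
  by [].
pose H := 1%:M - c *: (w^T *m w).
exists H; split.
- by rewrite /H raddfB/= trmx1 linearZ/= trmx_mul trmxK.
- rewrite /H mulmxBl mul1mx mulmxBr mulmx1 -scalemxAl -scalemxAr scalerA.
  rewrite -[w^T *m w *m _]mulmxA [w *m _]mulmxA ww mul_scalar_mx -scalemxAr scalerA.
  rewrite (_ : c * c * frobp w w = c + c); first by rewrite scalerDl opprB addrK subrK.
  by rewrite /c; field.
- rewrite /H mulmxBr mulmx1 -scalemxAr mulmxA.
  have -> : e *m w^T = (u 0 0 - 1)%:M.
    apply/matrixP => i j; rewrite !ord1 [RHS]mxE eqxx mulr1n.
    have := fe w; rewrite /frobp /mxtrace big_ord1 => ->.
    by rewrite wE !mxE !eqxx.
  rewrite mul_scalar_mx scalerA.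
  (* Since [|w|^2 = 2 - 2 u_0], the factor [c (u_0 - 1)] is -1. *)
  rewrite (_ : c * _ = -1); first by rewrite scaleN1r opprK wE addrC subrK.
  rewrite /c wwE; field; rewrite -wwE //.
Qed.

Lemma continuous_sum (T : topologicalType) (I : finType) (f : I -> T -> R) :
  (forall i, continuous (f i)) -> continuous (fun x => \sum_i f i x).
Proof.
move=> cf; apply: continuous_big => [|i _]; last exact: cf.
exact: add_continuous.
Qed.

(** [u] maximizes [|x Y|^2] on the compact unit sphere: stationarity makes it an eigenvector of
    [Y Y^T], and [Y != 0] makes the maximum positive. *)
Lemma top_singular m n (Y : 'M[R]_(m.+1, n)) : Y != 0 -> exists u : 'rV[R]_m.+1,
  [/\ frobp u u = 1, 0 < frobp (u *m Y) (u *m Y)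
    & u *m (Y *m Y^T) = frobp (u *m Y) (u *m Y) *: u].
Proof.
move=> Y0; pose q (x : 'rV[R]_m.+1) := frobp (x *m Y) (x *m Y).
pose S := [set x : 'rV[R]_m.+1 | frobp x x = 1].
have cent k (g : 'rV[R]_m.+1 -> 'rV[R]_k) :
    (forall j, continuous (fun x => g x 0 j)) -> continuous (fun x => frobp (g x) (g x)).
  move=> cg; have -> : (fun x => frobp (g x) (g x)) = (fun x => \sum_j g x 0 j * g x 0 j).
    by apply/funext => x; rewrite frobpE big_ord1.
  by apply: continuous_sum => j x; apply: (@cvgM _ _ (nbhs x)); exact: cg.
have cS : compact S.
  apply: bounded_closed_compact.
    exists 1; split => // M M1 x /= x1; apply: ltW; apply: le_lt_trans M1.
    rewrite [leLHS]/Num.norm/= mx_normrE; apply/bigmax_leP; split => // -[i j] _ /=.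
    rewrite -(@ler_pXn2r _ 2)// ?nnegrE// expr1n real_normK ?num_real//.
    by rewrite (le_trans (entry_le_frobp _ _ _))// x1.
  apply: (@closed_comp _ _ (fun x : 'rV[R]_m.+1 => frobp x x) [set 1]).
    by move=> x _; apply: (cent _ id) => j; exact: coord_continuous.
  exact: closed_eq.
have cq : continuous q.
  apply: cent => j.
  have -> : (fun x : 'rV[R]_m.+1 => (x *m Y) 0 j) = (fun x => \sum_k x 0 k * Y k j).
    by apply/funext => x; rewrite mxE.
  apply: continuous_sum => k x; apply: (@cvgM _ _ (nbhs x)).
    exact: coord_continuous.
  exact: cvg_cst.
have [|u uS umax] := EVT_max_rV _ cS (continuous_subspaceT cq).
  by exists (delta_mx 0 0); rewrite /S/= frobp_delta mxE !eqxx.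
rewrite inE/= in uS; exists u.
(* By homogeneity the maximum on the sphere bounds [q] everywhere. *)
have qle x : q x <= q u * frobp x x.
  have [x0|x0] := leP (frobp x x) 0.
    by rewrite (frobp_eq0 x0) /q mul0mx !frobp0l mulr0.
  pose r := Num.sqrt (frobp x x).
  have r0 : r != 0 by rewrite gt_eqF// sqrtr_gt0.
  have rr : r * r = frobp x x by rewrite -expr2 sqr_sqrtr// ltW.
  have : q (r^-1 *: x) <= q u.
    apply: umax; rewrite inE /S/= !frobpL -rr; field; exact: r0.
  rewrite /q -!scalemxAl !frobpL -rr -ler_pdivrMr; last by rewrite rr.
  by apply: le_trans; rewrite le_eqVlt; apply/orP; left; apply/eqP; field.
rewrite -/(q u).
have qu0 : 0 < q u.
  rewrite lt_neqAle frobp_ge0 andbT; apply: contra_neq Y0 => qu.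
  apply/row_matrixP => i; rewrite row0 rowE; apply: frobp_eq0.
  by have := qle (delta_mx 0 i); rewrite -qu mul0r.
split=> //.
(* First-order condition for the maximum of |x Y|^2 on the sphere. *)
have stat h : frobp (u *m Y) (h *m Y) = q u * frobp u h.
  pose a := frobp (u *m Y) (h *m Y) - q u * frobp u h.
  pose b := q h - q u * frobp h h.
  have ab t : 2 * t * a + t ^+ 2 * b <= 0.
    have := qle (u + t *: h).
    rewrite /q mulmxDl -scalemxAl !frobpL -/(q u) uS.
    rewrite (frobpC (h *m Y) (u *m Y)) (frobpC h u) /a /b /q.
    lra.
  have b0 : b <= 0 by have := ab 0; rewrite /b subr_le0 => _; exact: qle.
  apply/eqP; rewrite -subr_eq0 -/a; apply/eqP.
  have [bz|bn] := eqVneq b 0.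
    have := ab 1; have := ab (-1); rewrite bz; lra.
  have bl : b < 0 by rewrite lt_neqAle bn.
  (* The vertex of the parabola, where the value [a^2 / (- b)] can only be nonpositive if
     [a = 0]. *)
  have := ab (- a / b).
  have -> : 2 * (- a / b) * a + (- a / b) ^+ 2 * b = a ^+ 2 / (- b) by field.
  rewrite ler_pdivrMr ?oppr_gt0// mul0r => a0.
  by apply/eqP; rewrite -sqrf_eq0 eq_le a0 sqr_ge0.
apply/rowP => j; rewrite [RHS]mxE.
have := stat (delta_mx 0 j); rewrite frobp_delta => <-.
by rewrite -frobp_delta mulmxA [in LHS]frobp_mulr trmxK.
Qed.

(** Deflation: reflections carrying the first basis vectors to a top pair of singular vectors bring
    [Y] to block form with a singular value in the corner, and induction treats the other block.
    Keeping the positive values in an initial segment will give the rank. *)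
Lemma svd_exists_pre m n (Y : 'M[R]_(m, n)) : (m <= n)%N -> exists U s V k,
  is_svd Y U s V /\ forall i, (0 < s i) = (i < k)%N.
Proof.
elim: m n Y => [|m IH] n Y mn.
  exists 1%:M, (fun=> 0), 1%:M, 0; split; last by case.
  by split; rewrite ?trmx1 ?mulmx1//; apply/matrixP => -[].
case: n Y mn => // n Y mn.
have [Y0|Y0] := eqVneq Y 0.
  exists 1%:M, (fun=> 0), 1%:M, 0%N; split; last by move=> i; rewrite ltxx.
  split; rewrite ?trmx1 ?mulmx1 ?mul1mx// Y0.
  by apply/matrixP => i j; rewrite !mxE if_same.
have [u [u1 t0 uYY]] := top_singular Y0.
set t := frobp (u *m Y) (u *m Y) in t0 uYY.
pose a := Num.sqrt t.
have a0 : 0 < a by rewrite sqrtr_gt0.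
have aa : a * a = t by rewrite -expr2 sqr_sqrtr// ltW.
pose v := a^-1 *: (u *m Y).
have v1 : frobp v v = 1.
  by rewrite /v !frobpL -/t -aa; field; rewrite gt_eqF.
have uY : u *m Y = a *: v by rewrite /v scalerA divff ?gt_eqF// scale1r.
have vY : v *m Y^T = a *: u.
  rewrite /v -scalemxAl -mulmxA uYY -/t -aa scalerA mulrA mulVf ?gt_eqF// mul1r.
  by [].
have [H [HT HH Hu]] := householder u1.
have [K [KT KK Kv]] := householder v1.
have [B BHK] : {B : 'M[R]_(1 + m, 1 + n) | B = H *m Y *m K} by exists (H *m Y *m K).
(* The relations [u Y = a v] and [v Y^T = a u] clear the first row and the first column outside the
   corner. *)
have B0 j : B 0 j = a * (0 == j)%:R.
  have : row 0 B = a *: delta_mx 0 0.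
    rewrite rowE BHK !mulmxA Hu uY -scalemxAl; congr (_ *: _).
    by rewrite -Kv -mulmxA KK mulmx1.
  move/rowP/(_ j); rewrite !mxE => ->.
  by rewrite eqxx eq_sym.
have BT0 i : B i 0 = a * (0 == i)%:R.
  have : row 0 B^T = a *: delta_mx 0 0.
    rewrite rowE BHK !trmx_mul HT KT !mulmxA Kv vY -scalemxAl; congr (_ *: _).
    by rewrite -Hu -mulmxA HH mulmx1.
  move/rowP/(_ i); rewrite !mxE => ->.
  by rewrite eqxx eq_sym.
have BE : B = block_mx a%:M 0 0 (drsubmx B).
  rewrite -[LHS]submxK; congr block_mx.
  - by apply/matrixP => i j; rewrite !ord1 !mxE lshift0 B0 eqxx mulr1.
  - by apply/matrixP => i j; rewrite !ord1 !mxE lshift0 B0 mulr0.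
  - by apply/matrixP => i j; rewrite !ord1 !mxE lshift0 BT0 mulr0.
pose D k (W : 'M[R]_k) : 'M[R]_(1 + k) := block_mx 1%:M 0 0 W.
have DD k (W : 'M[R]_k) : W *m W^T = 1%:M -> D _ W *m (D _ W)^T = 1%:M.
  move=> WW; rewrite /D tr_block_mx trmx1 !trmx0 mulmx_block.
  by rewrite !mulmx0 !mul0mx !addr0 add0r mulmx1 WW -scalar_mx_block.
have [U [s [V [k [[UU VV s0 BsE] sk]]]]] := IH n (drsubmx B) mn.
pose s' (i : 'I_(1 + m)) := if unlift 0 i is Some j then s j else a.
exists (H *m D _ U), s', (K *m D _ V), k.+1.
have rE : rdiag (1 + n) s' = block_mx a%:M 0 0 (rdiag n s).
  apply/matrixP => i j; rewrite mxE /s'.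
  case: (unliftP 0 i) => [i' ->|->]; case: (unliftP 0 j) => [j' ->|->].
  - by rewrite -!rshift1 block_mxEdr mxE /= /bump/= !add1n eqSS.
  - by rewrite -rshift1 -(lshift0 n 0) block_mxEdl mxE/=.
  - by rewrite -rshift1 -(lshift0 m 0) block_mxEur mxE/=.
  - by rewrite -(lshift0 m 0) -(lshift0 n 0) block_mxEul !mxE.
split; first split.
- by rewrite trmx_mul HT mulmxA -(mulmxA H) DD// mulmx1.
- by rewrite trmx_mul KT mulmxA -(mulmxA K) DD// mulmx1.
- by move=> i; rewrite /s'; case: unlift => [j|]; [exact: s0|exact: ltW].
- have -> : Y = H *m B *m K.
    by rewrite BHK !mulmxA HH mul1mx -mulmxA KK mulmx1.
  rewrite trmx_mul KT !mulmxA; congr (_ *m K); rewrite -!mulmxA; congr (H *m _).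
  suff : B = D _ U *m (rdiag (1 + n) s' *m (D _ V)^T) by [].
  rewrite rE BE BsE /D tr_block_mx trmx1 !trmx0 !mulmx_block.
  by rewrite !(mulmx0, mul0mx, addr0, add0r) mulmx1 mul1mx mulmxA.
- move=> i; rewrite /s'; case: (unliftP 0 i) => [j ->|->]; last by rewrite a0.
  by rewrite sk /= /bump/= add1n ltnS.
Qed.

End svd.

(** * Soft thresholding as a projection *)

Section svd_rank.
Context {R : realType} {m n : nat}.
Hypothesis le_mn : (m <= n)%N.

Lemma rank_rdiag (s : 'I_m -> R) k : (k <= m)%N ->
  (forall i, (0 < s i) = (i < k)%N) -> (forall i, 0 <= s i) ->
  \rank (rdiag n s) = k.
Proof.
move=> km sk s0.
(* Past [k] the zero values are replaced by 1, which makes [diag_mx d] invertible; [pid_mx k] erases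
   these entries. *)
pose d : 'rV[R]_m := \row_i (if (i < k)%N then s i else 1).
have -> : rdiag n s = diag_mx d *m pid_mx k.
  apply/matrixP => i j; rewrite mul_diag_mx !mxE.
  have := sk i; case: (ltnP i k) => ik si.
    by rewrite andbT; case: eqP => _; rewrite ?mulr1 ?mulr0.
  rewrite andbF mulr0; case: eqP => // _.
  by apply/eqP; rewrite eq_le s0 leNgt si.
have fd : row_full (diag_mx d).
  rewrite row_full_unit unitmxE det_diag unitfE; apply/prodf_neq0 => i _.
  by rewrite mxE; case: ifP; rewrite -?sk ?oner_neq0// => /gt_eqF ->.
by rewrite (eqmxMfull _ fd) rank_pid_mx// (leq_trans km).
Qed.

Lemma orth_unit k (U : 'M[R]_k) : U *m U^T = 1%:M -> U \in unitmx.
Proof. by move=> /mulmx1_unit[]. Qed.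

Lemma svd_exists (Y : 'M[R]_(m, n)) : exists U s V,
  is_svd Y U s V /\ forall i, (0 < s i) = (i < \rank Y)%N.
Proof.
have [U [s [V [k [svd sk]]]]] := svd_exists_pre Y le_mn.
exists U, s, V; split=> // i; have [UU VV s0 ->] := svd.
have fV : row_free V^T by rewrite row_free_unit unitmx_tr orth_unit.
have fU : row_full U by rewrite row_full_unit orth_unit.
rewrite mxrankMfree// (eqmxMfull _ fU).
(* The [k] obtained above may exceed [m]; capping it changes nothing for indices in ['I_m]. *)
pose k' := minn k m.
have sk' j : (0 < s j) = (j < k')%N by rewrite sk /k' leq_min ltn_ord andbT.
by rewrite (rank_rdiag (k := k')) ?geq_minr.
Qed.

End svd_rank.

(** * The operator norm ball and its metric projection *)

Section spectral_ball.
Context {R : realType} {m n : nat} (lam : R).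
Hypotheses (le_mn : (m <= n)%N) (lam0 : 0 < lam).
Implicit Types X Y W P Q Z : 'M[R]_(m, n).

(** The operator norm ball of radius [lam], dual to the nuclear norm, written with squares to stay
    within [frobp]. *)
Definition opball W : Prop :=
  forall x : 'rV[R]_m, frobp (x *m W) (x *m W) <= lam ^+ 2 * frobp x x.

Lemma opball_entry W i j : opball W -> W i j <= lam.
Proof.
move=> /(_ (delta_mx 0 i)).
rewrite [X in _ * X]frobp_delta mxE !eqxx mulr1 -rowE => Wi.
have : W i j ^+ 2 <= lam ^+ 2.
  by apply: le_trans Wi; have := entry_le_frobp (row i W) 0 j; rewrite mxE.
move=> H; rewrite (le_trans (ler_norm _))// -(@ler_pXn2r _ 2)//.
  by rewrite real_normK ?num_real.
by rewrite nnegrE ltW.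
Qed.

Lemma opball_orth (U : 'M[R]_m) (V : 'M[R]_n) W : U *m U^T = 1%:M ->
  V *m V^T = 1%:M -> opball W -> opball (U *m W *m V).
Proof.
move=> UU VV BW x; rewrite !mulmxA frobp_mulr -(mulmxA _ V) VV mulmx1.
apply: le_trans (BW _) _.
by rewrite frobp_mulr -(mulmxA _ U) UU mulmx1.
Qed.

Lemma frobp_rdiag (d : 'I_m -> R) W :
  frobp (rdiag n d) W = \sum_i d i * W i (widen_ord le_mn i).
Proof.
rewrite frobpE; apply: eq_bigr => i _.
rewrite (bigD1 (widen_ord le_mn i))//= mxE eqxx big1 ?addr0// => j ji.
rewrite mxE; case: eqP => [ij|]; last by rewrite mul0r.
by case/eqP: ji; apply/val_inj.
Qed.

Lemma opball_rdiag (d : 'I_m -> R) : (forall i, 0 <= d i <= lam) -> opball (rdiag n d).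
Proof.
move=> dl x.
(* [D D^T] is diagonal with entries [d_i^2], so [|x D|^2 = \sum_i x_i^2 d_i^2]. *)
rewrite frobp_mulr; have -> : x *m rdiag n d *m (rdiag n d)^T = \row_i (x 0 i * d i ^+ 2).
  rewrite -mulmxA; apply/rowP => i; rewrite [RHS]mxE mxE (bigD1 i)//= big1.
    rewrite addr0 mxE (bigD1 (widen_ord le_mn i))//= big1.
      by rewrite addr0 !mxE eqxx expr2.
    move=> j ji; rewrite mxE; case: eqP => [ij|]; last by rewrite mul0r.
    by case/eqP: ji; apply/val_inj.
  move=> k ki; rewrite mxE big1 ?mulr0// => j _; rewrite !mxE.
  case: eqP => [kj|]; last by rewrite mul0r.
  case: eqP => [ij|]; last by rewrite mulr0.
  by case/eqP: ki; apply/val_inj; rewrite /= kj ij.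
rewrite !frobpE !big_ord1 mulr_sumr; apply: ler_sum => i _; rewrite mxE.
rewrite mulrA mulrC ler_wpM2r// -?expr2 ?sqr_ge0//.
by have /andP[d0 dl'] := dl i; rewrite ler_pXn2r// nnegrE// ltW.
Qed.

(** Duality of nuclear and operator norms: once [W] is rotated into the singular frame, only
    diagonal entries matter, each at most [lam]. *)
Lemma frobp_svd_le (U : 'M[R]_m) (V : 'M[R]_n) (d : 'I_m -> R) W :
  U *m U^T = 1%:M -> V *m V^T = 1%:M -> (forall i, 0 <= d i) -> opball W ->
  frobp (U *m rdiag n d *m V^T) W <= lam * \sum_i d i.
Proof.
move=> UU VV d0 BW; rewrite frobp_mulr frobp_mull trmxK frobp_rdiag mulr_sumr.
apply: ler_sum => i _; rewrite mulrC ler_wpM2r//; apply: opball_entry.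
by rewrite mulmxA; apply: opball_orth; rewrite ?trmxK //; exact: mulmx1C.
Qed.

Lemma frobp_svdE (U : 'M[R]_m) (V : 'M[R]_n) (d e : 'I_m -> R) :
  U *m U^T = 1%:M -> V *m V^T = 1%:M ->
  frobp (U *m rdiag n d *m V^T) (U *m rdiag n e *m V^T) = \sum_i d i * e i.
Proof.
move=> UU VV; rewrite frobp_orth ?trmxK; [|exact: mulmx1C|exact: mulmx1C].
by rewrite frobp_rdiag; apply: eq_bigr => i _; rewrite mxE eqxx.
Qed.

Lemma opball_svd (U : 'M[R]_m) (V : 'M[R]_n) (d : 'I_m -> R) :
  U *m U^T = 1%:M -> V *m V^T = 1%:M -> (forall i, 0 <= d i <= lam) ->
  opball (U *m rdiag n d *m V^T).
Proof.
move=> UU VV dl; apply: opball_orth => //; last exact: opball_rdiag.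
by rewrite trmxK; exact: mulmx1C.
Qed.

(* Variational characterization of the metric projection of Y on opball. *)
Definition is_proj Y P :=
  opball P /\ forall W, opball W -> frobp (Y - P) (W - P) <= 0.

(** Sum of the two variational inequalities, each tested at the other projection. *)
Lemma is_proj_firm Y1 Y2 P1 P2 : is_proj Y1 P1 -> is_proj Y2 P2 ->
  frobp (P1 - P2) (P1 - P2) <= frobp (Y1 - Y2) (P1 - P2).
Proof.
move=> [B1 H1] [B2 H2]; have := H1 _ B2; have := H2 _ B1.
rewrite !frobpL ?(frobpC P2 P1) ?(frobpC _ Y1) ?(frobpC _ Y2); lra.
Qed.

Lemma is_proj_lipschitz Y1 Y2 P1 P2 : is_proj Y1 P1 -> is_proj Y2 P2 ->
  frobp (P1 - P2) (P1 - P2) <= frobp (Y1 - Y2) (Y1 - Y2).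
Proof.
move=> p1 p2; have := is_proj_firm p1 p2.
have := frobp_ge0 ((P1 - P2) - (Y1 - Y2)).
move: (P1 - P2) (Y1 - Y2) => P Y; rewrite !frobpL (frobpC P Y); lra.
Qed.

Lemma is_proj_uniq Y P Q : is_proj Y P -> is_proj Y Q -> P = Q.
Proof.
move=> p q; apply/eqP; rewrite -subr_eq0; apply/eqP/frobp_eq0.
by have := is_proj_firm p q; rewrite subrr frobp0l.
Qed.

Lemma is_proj_orth (U : 'M[R]_m) (V : 'M[R]_n) Y P :
  U *m U^T = 1%:M -> V *m V^T = 1%:M ->
  is_proj Y P -> is_proj (U *m Y *m V) (U *m P *m V).
Proof.
move=> UU VV [BP HP]; split; first exact: opball_orth.
move=> W BW; have UU' := mulmx1C UU; have VV' := mulmx1C VV.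
have -> : W = U *m (U^T *m W *m V^T) *m V.
  by rewrite !mulmxA UU mul1mx -mulmxA VV' mulmx1.
rewrite -!mulmxBl -!mulmxBr frobp_orth//; apply: HP.
by apply: opball_orth; rewrite ?trmxK.
Qed.

(** Moreau decomposition: the singular values split as [s_i = p_i + d_i] with [p_i = min(s_i, lam)].
    Where [d_i > 0] one has [p_i = lam], so [P] attains the maximum [lam \sum_i d_i] of the form
    [<Y - P, .>] on the ball. *)
Lemma svst_proj Y : is_proj Y (Y - svst lam Y).
Proof.
rewrite /svst; case: pselect => [H|]; last first.
  case; have [U [s [V [svd _]]]] := svd_exists le_mn Y.
  by exists (U, s, V).
case: (projT2 (cid H)); move: (projT1 (cid H)) => [[U s] V] /= UU VV s0 YE.
pose p i := Num.min (s i) lam; pose d i := Num.max (s i - lam) 0.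
have pl i : 0 <= p i <= lam.
  by rewrite /p; case: (leP (s i) lam) => sl; rewrite ?s0 ?lexx ?sl ?ltW.
have d0 i : 0 <= d i by rewrite /d le_max lexx orbT.
have PE : Y - U *m rdiag n d *m V^T = U *m rdiag n p *m V^T.
  rewrite YE -mulmxBl -mulmxBr; congr (_ *m _ *m _).
  apply/matrixP => i j; rewrite !mxE; case: eqP => _; last by rewrite subr0.
  by rewrite /p /d; case: (leP (s i) lam) => sl;
    [rewrite max_r ?subr0 ?subr_le0|rewrite max_l ?subr_ge0 ?ltW//; ring].
rewrite -/d PE; split; first exact: opball_svd.
move=> W BW.
have -> : Y - U *m rdiag n p *m V^T = U *m rdiag n d *m V^T.
  by rewrite -PE opprB addrC subrK.
rewrite frobpDr frobpNr frobp_svdE// subr_le0.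
apply: le_trans (frobp_svd_le UU VV d0 BW) _.
rewrite mulr_sumr; apply: ler_sum => i _; rewrite mulrC /d /p.
by case: (leP (s i) lam) => sl; [rewrite max_r ?subr_le0// !mul0r|].
Qed.

(** The decomposition chosen for [U Y V] need not be the rotated one of [Y]; uniqueness of the
    projection makes the choice irrelevant. *)
Lemma svst_orth (U : 'M[R]_m) (V : 'M[R]_n) Y : U *m U^T = 1%:M -> V *m V^T = 1%:M ->
  svst lam (U *m Y *m V) = U *m svst lam Y *m V.
Proof.
move=> UU VV.
have := is_proj_uniq (svst_proj (U *m Y *m V)) (is_proj_orth UU VV (svst_proj Y)).
rewrite mulmxBr mulmxBl => /addrI /oppr_inj.
by [].
Qed.

Lemma opball_frobp P : opball P -> frobp P P <= m%:R * lam ^+ 2.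
Proof.
move=> BP; rewrite frobpE.
have -> : m%:R * lam ^+ 2 = \sum_(i < m) lam ^+ 2 by rewrite sumr_const card_ord mulr_natl.
apply: ler_sum => i _; have := BP (delta_mx 0 i).
rewrite [X in _ * X]frobp_delta mxE !eqxx mulr1 -rowE frobpE big_ord1.
by under eq_bigr do rewrite !mxE.
Qed.

Lemma svst_loss_le (U : 'M[R]_m) (V : 'M[R]_n) (s c : 'I_m -> R) (a t : R) X C Z :
  U *m U^T = 1%:M -> V *m V^T = 1%:M -> (forall i, 0 <= s i) -> (forall i, 0 <= c i) ->
  (forall i, s i <= a * c i) -> 0 <= a -> 0 < t ->
  X = U *m rdiag n s *m V^T -> C = U *m rdiag n c *m V^T ->
  frob2 (svst lam (X + Z) - X) <= frob2 (svst lam (t *: C + Z) - t *: C)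
    + a / t * (m%:R * lam ^+ 2 + frob2 Z).
Proof.
move=> UU VV s0 c0 sc a0 t0 XE CE.
have [B0 H0] := svst_proj (X + Z); have [B1 H1] := svst_proj (t *: C + Z).
move: (svst lam (X + Z)) (svst lam (t *: C + Z)) B0 H0 B1 H1 => f0 f1.
have [P0 P0E] : {P0 | P0 = X + Z - f0} by exists (X + Z - f0).
have [P1 P1E] : {P1 | P1 = t *: C + Z - f1} by exists (t *: C + Z - f1).
have -> : f1 - t *: C = Z - P1.
  by rewrite P1E; apply/matrixP => i j; rewrite !mxE; ring.
have -> : f0 - X = Z - P0.
  by rewrite P0E; apply/matrixP => i j; rewrite !mxE; ring.
rewrite -P0E -P1E => B0 H0 B1 H1.
(* The point of the ball where [<C, .>] attains its maximum [lam \sum_i c_i]. *)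
pose Q := U *m rdiag n (fun=> lam) *m V^T.
have BQ : opball Q by apply: opball_svd => // i; rewrite lexx ltW.
have QQ := opball_frobp BQ.
have CQ : frobp C Q = lam * \sum_i c i.
  by rewrite CE /Q frobp_svdE// mulrC mulr_suml.
have XP0 : frobp X P0 <= lam * \sum_i s i by rewrite XE; exact: frobp_svd_le.
(* Duality bound for [a C - X], whose singular values [a c_i - s_i] are nonnegative in the common
   frame. *)
have XP1 : lam * \sum_i s i - frobp X P1 <= a * frobp C (Q - P1).
  have -> : frobp C (Q - P1) = lam * (\sum_i c i) - frobp C P1.
    by rewrite !frobpL CQ.
  have := @frobp_svd_le U V (fun i => a * c i - s i) P1 UU VV.
  have -> : U *m rdiag n (fun i => a * c i - s i) *m V^T = a *: C - X.
    rewrite CE XE scalemxAl scalemxAr -mulmxBl -mulmxBr; congr (_ *m _ *m _).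
    apply/matrixP => i j; rewrite !mxE; case: eqP => // _.
    by rewrite mulr0 subr0.
  rewrite sumrB -mulr_sumr !frobpL => H.
  have {}H : a * frobp C P1 - frobp X P1 <= lam * (a * \sum_i c i - \sum_i s i).
    by apply: H => // i; rewrite subr_ge0.
  lra.
(* Testing [P1] against [Q] gives [t <C, Q - P1> <= <Z - P1, P1 - Q>]. Completing the square in [P1]
   bounds this by [|Q - Z|^2 / 4], hence by [(|Q|^2 + |Z|^2) / 2]. *)
have tC : a * frobp C (Q - P1) <= a / t * (m%:R * lam ^+ 2 + frob2 Z) / 2.
  rewrite -!mulrA ler_wpM2l// mulrC ler_pdivlMr// mulrC.
  have := H1 Q BQ; have := frobp_ge0 (Q + Z - 2 *: P1); have := frobp_ge0 (Q + Z).
  rewrite frob2E !frobpL (frobpC Z Q) (frobpC P1 Q) (frobpC P1 Z).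
  move: QQ; lra.
move: (a / t * _) tC => e tC.
(* Expanding [|Z - P1|^2] around [P0] gives [|Z - P0|^2 <= |Z - P1|^2 + 2 <X, P0 - P1>], and the
   last term is at most [e]. *)
have := H0 P1 B1; have := frobp_ge0 (P1 - P0).
rewrite !frob2E !frobpL (frobpC P0 P1) (frobpC P0 Z) (frobpC P1 Z).
move: XP1 tC XP0; rewrite !frobpL; lra.
Qed.

End spectral_ball.

(** * Risk *)

Section svst_risk.
Context {R : realType} {m n : nat} (lam : R).
Hypotheses (le_mn : (m <= n)%N) (lam0 : 0 < lam).
Local Notation M := 'M[R]_(m, n).
Local Notation sigma := ((Num.sqrt (n%:R : R))^-1).
Implicit Types X Z C : M.

Definition loss X Z : \bar R := (frob2 (svst lam (X + sigma *: Z) - X))%:E.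

Lemma loss_ge0 X Z : (0 <= loss X Z)%E.
Proof. by rewrite lee_fin frob2E frobp_ge0. Qed.

Lemma riskE X : risk (svst lam) X = ((m%:R)^-1%:E * gaussE (loss X))%E.
Proof. by []. Qed.

Lemma measurable_frob2 (f : (nat -> R) -> M) :
  (forall i j, measurable_fun [set: rseq R] (fun z => f z i j)) ->
  measurable_fun [set: rseq R] (fun z => frob2 (f z)).
Proof.
move=> mf; rewrite /frob2; apply: measurable_sum => i.
by apply: measurable_sum => j; apply: measurable_funX; exact: mf.
Qed.

Lemma measurable_mat_entry i j :
  measurable_fun [set: rseq R] (fun z => (mat_of_seq z : M) i j).
Proof.
rewrite (_ : (fun z => _) = (fun z => z (i * n + j)%N)); first exact: measurable_coord.
by apply/funext => z; rewrite mxE.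
Qed.

(** An arbitrary choice of decompositions says nothing about measurability; it comes from the
    projection [P] being 1-Lipschitz, since the error equals [sigma Z - P Z]. *)
Lemma measurable_loss X : meas_mat (loss X).
Proof.
apply/measurable_EFinP; apply: (measurable_frob2
  (f := fun z => svst lam (X + sigma *: mat_of_seq z) - X)) => i j.
pose P Z := X + sigma *: Z - svst lam (X + sigma *: Z).
have mP : measurable_fun [set: rseq R] ((fun Z => P Z i j) \o mat_of_seq).
  apply: (measurable_mat_lipschitz (K := `|sigma|)) => Z Y.
  have := is_proj_lipschitz (svst_proj le_mn lam0 (X + sigma *: Z))
    (svst_proj le_mn lam0 (X + sigma *: Y)).
  rewrite -/(P Z) -/(P Y) => PZY.
  rewrite -(@ler_pXn2r _ 2)// ?nnegrE ?mulr_ge0 ?sumr_ge0//; last first.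
    by move=> k _; exact: sumr_ge0.
  rewrite real_normK ?num_real//.
  have := entry_le_frobp (P Z - P Y) i j; rewrite !mxE => /le_trans; apply.
  apply: le_trans PZY _.
  have -> : X + sigma *: Z - (X + sigma *: Y) = sigma *: (Z - Y).
    by rewrite opprD addrACA subrr add0r scalerBr.
  rewrite frobpZl frobpZr mulrA exprMn real_normK ?num_real// -expr2.
  rewrite ler_wpM2l ?sqr_ge0//.
  apply: le_trans (frobp_le_sum _) _.
  by under eq_bigr do under eq_bigr do rewrite !mxE.
have -> : (fun z => (svst lam (X + sigma *: mat_of_seq z) - X) i j) =
    (fun z => sigma * (mat_of_seq z : M) i j - P (mat_of_seq z) i j).
  by apply/funext => z; rewrite /P !mxE; ring.
apply: measurable_funB => //; apply: measurable_funM => //.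
exact: measurable_mat_entry.
Qed.

Lemma measurable_quadratic (a b : R) :
  meas_mat (fun Z : M => (a + b * frob2 Z)%:E).
Proof.
apply/measurable_EFinP; apply: measurable_funD => //; apply: measurable_funM => //.
by apply: measurable_frob2 => i j; exact: measurable_mat_entry.
Qed.

(** Rotate the noise, which keeps its law, then use the equivariance of [svst]. *)
Lemma gauss_loss_orth (U : 'M[R]_m) (V : 'M[R]_n) X :
  U *m U^T = 1%:M -> V *m V^T = 1%:M ->
  gaussE (loss (U *m X *m V)) = gaussE (loss X).
Proof.
move=> UU VV; rewrite -(gaussE_orthogonal UU VV (measurable_loss _)); last exact: loss_ge0.
congr gaussE; apply/funext => Z; rewrite /loss.
have -> : U *m X *m V + sigma *: (U *m Z *m V) = U *m (X + sigma *: Z) *m V.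
  by rewrite mulmxDr mulmxDl scalemxAl scalemxAr.
rewrite svst_orth// -mulmxBl -mulmxBr !frob2E frobp_orth//; exact: mulmx1C.
Qed.

(** Bounds [|P|^2 + |N|^2] for [P] in the ball and [N = sigma Z]; both risk estimates are multiples
    of its expectation. *)
Definition noise Z : \bar R := (m%:R * lam ^+ 2 + sigma ^+ 2 * frob2 Z)%:E.

Lemma noise_ge0 Z : (0 <= noise Z)%E.
Proof.
rewrite lee_fin; apply: addr_ge0; apply: mulr_ge0; rewrite ?sqr_ge0//.
by rewrite frob2E frobp_ge0.
Qed.

Lemma gauss_noise_lty : (gaussE noise < +oo)%E.
Proof.
apply: gaussE_frob2_lty; last exact: sqr_ge0.
by apply: mulr_ge0 => //; exact: sqr_ge0.
Qed.

(** From [|N - P|^2 <= 2 |N|^2 + 2 |P|^2]; uniformity in [X] makes the supremum of the risks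
    finite. *)
Lemma gauss_loss_le X : (gaussE (loss X) <= 2%:E * gaussE noise)%E.
Proof.
rewrite -gaussEZ//; [|exact: measurable_quadratic|exact: noise_ge0].
apply: gaussE_le => [||Z|Z].
- exact: measurable_loss.
- rewrite (_ : (fun Z => _) = (fun Z : M => ((2 * (m%:R * lam ^+ 2)) +
      (2 * sigma ^+ 2) * frob2 Z)%:E)); first exact: measurable_quadratic.
  by apply/funext => Z; rewrite /noise -EFinM; congr EFin; ring.
- exact: loss_ge0.
- rewrite /loss /noise -EFinM lee_fin.
  have [BP _] := svst_proj le_mn lam0 (X + sigma *: Z).
  have [P PE] : {P | P = X + sigma *: Z - svst lam (X + sigma *: Z)} by eexists.
  have -> : svst lam (X + sigma *: Z) - X = sigma *: Z - P.
    by rewrite PE; apply/matrixP => i j; rewrite !mxE; ring.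
  have := opball_frobp BP; rewrite -PE => PP.
  have := frobp_ge0 (sigma *: Z + P).
  rewrite !frob2E !frobpL (frobpC P Z); lra.
Qed.

Lemma gauss_loss_ray X C : (\rank X <= \rank C)%N -> exists2 a, 0 <= a &
  forall t, 0 < t ->
    (gaussE (loss X) <= gaussE (loss (t *: C)) + (a / t)%:E * gaussE noise)%E.
Proof.
move=> XC.
have [U [s [V [[UU VV s0 XE] sr]]]] := svd_exists le_mn X.
have [U1 [c [V1 [[UU1 VV1 c0 CE] cr]]]] := svd_exists le_mn C.
(* A sum dominating every ratio [s_i / c_i]. The rank hypothesis gives [c_i > 0] wherever [s_i > 0];
   where [c_i = 0] the quotient is 0 by convention. *)
pose a := \sum_i s i / c i.
have a0 : 0 <= a by apply: sumr_ge0 => i _; rewrite divr_ge0.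
have sc i : s i <= a * c i.
  have [si|si] := leP (s i) 0; first by rewrite (le_trans si)// mulr_ge0.
  have ci : 0 < c i by rewrite cr (leq_trans _ XC)// -sr.
  rewrite -ler_pdivrMr// /a (bigD1 i)//= lerDl sumr_ge0// => j _.
  by rewrite divr_ge0.
exists a => // t t0.
(* [C] moved to the singular frame of [X], with its singular values kept. *)
pose C' := U *m rdiag n c *m V^T.
have -> : gaussE (loss (t *: C)) = gaussE (loss (t *: C')).
  have -> : t *: C' = (U *m U1^T) *m (t *: C) *m (V1 *m V^T).
    rewrite -scalemxAr -scalemxAl CE; congr (_ *: _).
    rewrite !mulmxA -(mulmxA U) (mulmx1C UU1) mulmx1.
    by rewrite -(mulmxA _ V1^T) (mulmx1C VV1) mulmx1.
  rewrite gauss_loss_orth//.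
    by rewrite trmx_mul trmxK mulmxA -(mulmxA U) (mulmx1C UU1) mulmx1.
  rewrite trmx_mul trmxK mulmxA -(mulmxA V1) (mulmx1C VV) mulmx1.
  by [].
have at0 : 0 <= a / t by rewrite divr_ge0// ltW.
have mq : meas_mat (fun Z : M => ((a / t)%:E * noise Z)%E).
  rewrite (_ : (fun Z => _) = (fun Z : M => (((a / t) * (m%:R * lam ^+ 2)) +
      ((a / t) * sigma ^+ 2) * frob2 Z)%:E)); first exact: measurable_quadratic.
  by apply/funext => Z; rewrite /noise -EFinM; congr EFin; ring.
rewrite -gaussEZ//; [|exact: measurable_quadratic|exact: noise_ge0].
rewrite -gaussED//; [|exact: measurable_loss|exact: loss_ge0|]; last first.
  by move=> Z; rewrite mule_ge0 ?noise_ge0// lee_fin.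
apply: gaussE_le => [||Z|Z].
- exact: measurable_loss.
- by apply: emeasurable_funD => //; exact: measurable_loss.
- exact: loss_ge0.
- rewrite /loss /noise -EFinM -EFinD lee_fin.
  have := svst_loss_le le_mn lam0 (sigma *: Z) UU VV s0 c0 sc a0 t0 XE (erefl C').
  by rewrite [frob2 (_ *: Z)]frob2E !frobpL mulrA -expr2 -frob2E.
Qed.

End svst_risk.

Theorem theorem1 (R : realType) (lam : R) (m n r : nat) :
  0 < lam -> (0 < m)%N -> (m <= n)%N -> (1 <= r)%N -> (r <= m)%N ->
  forall C : 'M[R]_(m, n), \rank C = r ->
  (risk (svst lam) (mu *: C) @[mu --> +oo%R] -->
   ereal_sup [set risk (svst lam) X0 | X0 in [set X0 : 'M[R]_(m, n) | (\rank X0 <= r)%N]])%E.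
Proof.
move=> lam0 m0 mn _ _ C Cr.
have mr0 : 0 < (m%:R : R)^-1 by rewrite invr_gt0 ltr0n.
pose K := fine (gaussE (@noise R m n lam)).
have KE : gaussE (@noise R m n lam) = K%:E.
  by rewrite /K fineK// ge0_fin_numE ?gauss_noise_lty ?gaussE_ge0//; exact: noise_ge0.
have K0 : 0 <= K by rewrite -lee_fin -KE gaussE_ge0//; exact: noise_ge0.
pose h X := fine (risk (svst lam) (X : 'M[R]_(m, n))).
have risk0 X : (0 <= risk (svst lam) (X : 'M[R]_(m, n)))%E.
  rewrite riskE; apply: mule_ge0; first by rewrite lee_fin ltW.
  by apply: gaussE_ge0; exact: loss_ge0.
have risk_le X : (risk (svst lam) (X : 'M[R]_(m, n)) <= (m%:R^-1 * (2 * K))%:E)%E.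
  rewrite riskE EFinM lee_wpmul2l ?lee_fin ?(ltW mr0)//.
  by rewrite EFinM -KE; exact: gauss_loss_le.
have hE X : risk (svst lam) X = (h X)%:E.
  by rewrite /h fineK// ge0_fin_numE// (le_lt_trans (risk_le X))// ltry.
set S := [set _ | _ in _].
have supE : ereal_sup S = (fine (ereal_sup S))%:E.
  rewrite fineK// ge0_fin_numE.
    by apply: le_lt_trans (ltry (m%:R^-1 * (2 * K))); apply: ub_ereal_sup => _ [X _ <-].
  by apply: le_trans (risk0 0) _; apply: ereal_sup_ubound; exists 0; rewrite //= mxrank0.
set l := fine (ereal_sup S) in supE.
rewrite supE; under eq_cvg do rewrite hE.
apply: cvg_EFin; first by near=> t.
apply/cvgrPdist_le => e e0 /=.
(* A nearly optimal [X] squeezes the limit: [l - e / 2 < h X <= h (t C) + a / t], while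
   [h (t C) <= l] because scaling does not raise the rank. *)
have [X Xr Xe] : exists2 X : 'M[R]_(m, n), (\rank X <= r)%N & l - e / 2 < h X.
  have : ((l - e / 2)%:E < ereal_sup S)%E by rewrite supE lte_fin gtrBl divr_gt0.
  by move=> /ereal_sup_gt[_ [X Xr <-]]; rewrite hE lte_fin => ?; exists X.
have hl t : h (t *: C) <= l.
  rewrite -lee_fin -hE -supE; apply: ereal_sup_ubound; exists (t *: C) => //=.
  by rewrite -Cr (leq_trans (mxrankS (scalemx_sub _ (submx_refl C)))).
have [a a0 aP] : exists2 a, 0 <= a & forall t, 0 < t -> h X <= h (t *: C) + a / t.
  rewrite -Cr in Xr; have [a a0 aP] := gauss_loss_ray mn lam0 Xr.
  exists (m%:R^-1 * (a * K)); first by rewrite !mulr_ge0// ltW.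
  move=> t t0; rewrite -lee_fin EFinD -!hE !riskE.
  have -> : m%:R^-1 * (a * K) / t = m%:R^-1 * (a / t * K) by ring.
  rewrite EFinM [(a / t * K)%:E]EFinM -KE -ge0_muleDr.
  - by rewrite lee_wpmul2l ?lee_fin ?(ltW mr0)// aP.
  - by apply: gaussE_ge0; exact: loss_ge0.
  - by rewrite KE -EFinM lee_fin mulr_ge0// divr_ge0// ltW.
near=> t.
have t0 : 0 < t by near: t; apply: nbhs_pinfty_gt; rewrite num_real.
(* Beyond this threshold [a / t < e / 2]. *)
have te : 2 * a / e < t by near: t; apply: nbhs_pinfty_gt; rewrite num_real.
have := aP t t0; have := hl t.
have : a / t < e / 2.
  by rewrite ltr_pdivrMr//; move: te; rewrite ltr_pdivrMr//; lra.
rewrite ler_norml; lra.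
Unshelve. all: by end_near. Qed.
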